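(* If $G$ is a natural unit interval graph, then \[ X_G(\bm x)=M_{(G,\emptyset,\emptyset)}, \] which is $e$-positive, i.e. has nonnegative coefficients in the elementary symmetric function basis.
   Context: $X_G(\bm x)=\sum_\kappa\prod_{v\in V(G)}x_{\kappa(v)}$ is the chromatic symmetric function in infinitely many variables $\bm x=(x_1,x_2,\dots)$, summed over proper colorings $\kappa:V(G)\to\{1,2,\dots\}$. $e_i$ is the elementary symmetric function in $\bm x$, $e_0=1$. A graph $G$ on $[n]=\{1,\dots,n\}$ is a natural unit interval graph if whenever $\{p,q\}$ is an edge with $p<q$, then $\{p,r\},\{r,q\}$ are edges for all $p<r<q$. Let $I_k$ be the set of $k$-tuples of distinct positive integers and $V_k$ the $\mathbb{Q}(e_1,e_2,\dots)$-vector space with basis $\{b_\sigma:\sigma\in I_k\}$; $V_0$ is one-dimensional with basis $b_\emptyset$, and a linear map $V_0\to V_0$ is identified with a scalar. For $\sigma\in I_k$ set \[ A(1\mid\sigma)=\prod_r\frac{\sigma_r-1}{\sigma_r},\qquad A(\sigma_r+1\mid\sigma)=\frac{\sigma_r+1}{\sigma_r}\prod_{r'\ne r}\frac{\sigma_r-\sigma_{r'}+1}{\sigma_r-\sigma_{r'}}, \] and $A(y\mid\sigma)=0$ for all other positive integers $y$. Define $M_k\colon V_k\to V_{k+1}$ and $D_k\colon V_k\to V_{k-1}$ by \[ M_kb_\sigma=\sum_{y\notin\sigma}A(y\mid\sigma)\,b_{\sigma,y},\qquad D_kb_\sigma=\frac{e_{\sigma_1}}{e_{\sigma_1-1}}\,b_{\sigma_2,\dots,\sigma_k},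 \] where $b_{\sigma,y}$ is indexed by $\sigma$ with $y$ appended. Definition of $M_{(G,\emptyset,\emptyset)}\colon V_0\to V_0$. Build $G$ one vertex at a time, starting with no marked vertices. For $v=1,\dots,n$ in order, let $r$ be the number of neighbors of $v$ smaller than $v$; these are the $r$ most recently marked vertices. If currently $s$ vertices are marked, apply $D_s,D_{s-1},\dots,D_{r+1}$ in this order (forgetting the oldest marked vertices), then apply $M_r$ (so that $v$ and its smaller neighbors are marked). After vertex $n$, apply operators $D$ until no vertex is marked. $M_{(G,\emptyset,\emptyset)}$ is the composition of all these operators, later steps on the left. *)

(* Defs.v *)
From HB Require Import structures.
From mathcomp Require Import all_boot all_order all_algebra.
From mathcomp Require Import fraction boolp finmap monalg.

Set Implicit Arguments.
Unset Strict Implicit.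
Unset Printing Implicit Defensive.

Import GRing.Theory.
Local Open Scope ring_scope.

(* Q[e_1, e_2, ...] is {malg rat[{cmonom nat}]}, and Q(e_1, e_2, ...) is its   *)
(* field of fractions.  The lemmas below provide the required integral domain *)
(* structure, by comparing leading monomials for the lexicographic order.     *)
Section PolyIntegral.
Local Open Scope nat_scope.
Implicit Types m : {cmonom nat}.

Definition mlt m1 m2 := exists2 i, m1 i < m2 i & forall j, j < i -> m1 j = m2 j.

Lemma mlt_irr m : ~ mlt m m.
Proof. by case=> i; rewrite ltnn. Qed.

Lemma mlt_trans m1 m2 m3 : mlt m1 m2 -> mlt m2 m3 -> mlt m1 m3.
Proof.
move=> [i lt_i eq_i] [j lt_j eq_j]; case: (ltngtP i j) => [lt|lt|eq_ij].
- exists i; first by rewrite -(eq_j i).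
  by move=> k lt_k; rewrite eq_i // eq_j // (ltn_trans lt_k).
- exists j; first by rewrite eq_i.
  by move=> k lt_k; rewrite -eq_j // eq_i // (ltn_trans lt_k).
- subst j; exists i; first exact: ltn_trans lt_j.
  by move=> k lt_k; rewrite eq_i ?eq_j.
Qed.

Lemma mlt_total m1 m2 : [\/ m1 = m2, mlt m1 m2 | mlt m2 m1].
Proof.
have [->|neq] := eqVneq m1 m2; first by constructor 1.
have /existsNP [i0 /eqP Pi0] : ~ forall i, m1 i = m2 i.
  by move/cmP => e; rewrite e in neq.
have ex : exists i, m1 i != m2 i by exists i0.
case: (ex_minnP ex) => i nei mini.
have below j : j < i -> m1 j = m2 j.
  by move=> lt; apply/eqP; apply: contraTT lt => /mini; rewrite -leqNgt.
case: (ltngtP (m1 i) (m2 i)) nei => // lt _; first by constructor 2; exists i.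
by constructor 3; exists i => // j /below.
Qed.

Lemma mltM2l m m1 m2 : mlt m1 m2 -> mlt (mmul m m1) (mmul m m2).
Proof.
case=> i lt eq; exists i; first by rewrite !cmM ltn_add2l.
by move=> j /eq e; rewrite !cmM e.
Qed.

Lemma mlt_mul m1 m2 m3 m4 : m1 = m3 \/ mlt m1 m3 -> m2 = m4 \/ mlt m2 m4 ->
  mmul m1 m2 = mmul m3 m4 -> m1 = m3 /\ m2 = m4.
Proof.
move=> [-> | lt13] [-> | lt24] // e.
- by case: (@mlt_irr (mmul m3 m4)); rewrite -{1}e; apply: mltM2l.
- case: (@mlt_irr (mmul m3 m4)); rewrite -{1}e ![mmul _ m4]mulmC.
  exact: mltM2l.
- case: (@mlt_irr (mmul m3 m4)); rewrite -{1}e.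
  apply: mlt_trans (mltM2l _ lt24) _.
  by rewrite ![mmul _ m4]mulmC; apply: mltM2l.
Qed.

Lemma mlt1 m : ~ mlt m mone.
Proof. by case=> i; rewrite cm1. Qed.

Lemma mlt_max (s : seq {cmonom nat}) : s != [::] ->
  exists2 m, m \in s & forall m', m' \in s -> m' = m \/ mlt m' m.
Proof.
elim: s => [//|a [_ _|b s IHs _]].
  by exists a; rewrite ?inE // => m'; rewrite inE => /eqP; left.
have [//|m ms maxm] := IHs.
case: (mlt_total a m) => [eq|lt|lt].
- exists m; first by rewrite inE ms orbT.
  by move=> m'; rewrite inE => /orP[/eqP ->|/maxm//]; left.
- exists m; first by rewrite inE ms orbT.
  by move=> m'; rewrite inE => /orP[/eqP ->|/maxm//]; right.
- exists a; first by rewrite inE eqxx.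
  move=> m'; rewrite inE => /orP[/eqP ->|/maxm [->|lt']]; [by left|by right|].
  by right; apply: mlt_trans lt.
Qed.

End PolyIntegral.

Section PolyIdomain.
Variable R : idomainType.
Local Notation P := {malg R[{cmonom nat}]}.
Implicit Types p q : P.

Lemma malg_lead p : p != 0 -> exists2 m, m \in msupp p &
  forall m', m' \in msupp p -> m' = m \/ mlt m' m.
Proof.
move=> p0; apply: (@mlt_max (msupp p)); apply: contraNneq p0 => s0.
by rewrite -msupp_eq0; apply/eqP/fsetP => x; rewrite in_fset0 -[LHS]/(x \in enum_fset (msupp p)) s0.
Qed.

Lemma malg_leadM p q mp mq :
  mp \in msupp p -> (forall m', m' \in msupp p -> m' = mp \/ mlt m' mp) ->
  mq \in msupp q -> (forall m', m' \in msupp q -> m' = mq \/ mlt m' mq) ->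
  (p * q)@_(mmul mp mq) = p@_mp * q@_mq.
Proof.
move=> mp_in maxp mq_in maxq.
rewrite mcoeffMl (big_fsetD1 mp) //= [X in _ + X]big1_fset ?addr0; last first.
  move=> k1; rewrite in_fsetD1 => /andP[nek1 k1p] _.
  rewrite big1_fset // => k2 k2q _; case: eqP => // e.
  by have [e1] := mlt_mul (maxp _ k1p) (maxq _ k2q) e; rewrite e1 eqxx in nek1.
rewrite (big_fsetD1 mq) //= eqxx big1_fset ?addr0 // => k2.
rewrite in_fsetD1 => /andP[nek2 k2q] _; case: eqP => // e.
have [_ e2] := mlt_mul (or_introl (erefl mp)) (maxq _ k2q) e.
by rewrite e2 eqxx in nek2.
Qed.

Definition malg_unit : {pred P} :=
  fun p => (p == (p@_mone)%:MP) && (p@_mone \is a GRing.unit).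

Definition malg_inv p : P := if malg_unit p then ((p@_mone)^-1)%:MP else p.

Lemma malg_mulVp : {in malg_unit, left_inverse 1 malg_inv *%R}.
Proof.
move=> p Up; rewrite /malg_inv ifT //; case/andP: Up => /eqP Ep Up.
rewrite mul_malgC; apply/malgP => k; rewrite mcoeffZ mcoeff1.
have -> : p@_k = p@_mone *+ (k == mone) by rewrite -mcoeffC -Ep.
by rewrite mulrnAr mulVr.
Qed.

Lemma malg_unitPl p q : q * p = 1 -> malg_unit p.
Proof.
move=> qp1.
have neq0 : (q != 0) && (p != 0).
  by apply/andP; split; apply/eqP => e; move: qp1; 
    rewrite e ?mul0r ?mulr0 => /eqP; rewrite eq_sym oner_eq0.
have /andP[/malg_lead [mq mqin mqmax] /malg_lead [mp mpin mpmax]] := neq0.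
have := malg_leadM mqin mqmax mpin mpmax; rewrite qp1 mcoeff1.
case: eqP => [e _|_ /esym/eqP]; last first.
  by rewrite mulf_eq0 !mcoeff_eq0 mqin mpin.
have [mq1 mp1] := unitm _ _ e; subst mq mp.
have cst (r : P) : (forall m', m' \in msupp r -> m' = mone \/ mlt m' mone) ->
    r = (r@_mone)%:MP.
  move=> rmax; apply/malgP => k; rewrite mcoeffC; case: eqP => [->//|ne].
  by apply: mcoeff_outdom; apply/negP => /rmax [//|/mlt1].
apply/andP; split; first exact/eqP/cst.
apply/unitrPr; exists (q@_mone).
have : ((q@_mone)%:MP * p)@_mone = 1 by rewrite -(cst q mqmax) qp1 mcoeff1 eqxx.
by rewrite mcoeffCM mulrC.
Qed.

Lemma malg_inv_out : {in [predC malg_unit], malg_inv =1 id}.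
Proof. by move=> p /negbTE Up; rewrite /malg_inv; move: Up; rewrite -topredE /= => ->. Qed.

HB.instance Definition _ := GRing.ComNzRing_hasMulInverse.Build P
  malg_mulVp malg_unitPl malg_inv_out.

Lemma malg_idomain : GRing.integral_domain_axiom P.
Proof.
move=> p q pq0; apply/norP => -[/malg_lead [mp mpin mpmax]].
move=> /malg_lead [mq mqin mqmax].
have := malg_leadM mpin mpmax mqin mqmax; rewrite pq0 mcoeff0 => /esym/eqP.
by rewrite mulf_eq0 !mcoeff_eq0 mpin mqin.
Qed.

HB.instance Definition _ := GRing.ComUnitRing_isIntegral.Build P malg_idomain.

End PolyIdomain.

(* Formal power series over Q in x_1, x_2, ... given by their coefficients;   *)
(* the index i : nat of a monomial {cmonom nat} stands for x_{i+1}.           *)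
Definition fps : Type := {cmonom nat} -> rat.

Section FPS.
Implicit Types (m d : {cmonom nat}) (f g h : fps).

HB.instance Definition _ := gen_eqMixin fps.
HB.instance Definition _ := gen_choiceMixin fps.

Definition fps_add f g : fps := fun m => f m + g m.
Definition fps_opp f : fps := fun m => - f m.
Definition fpsC (c : rat) : fps := fun m => c *+ (m == mone).

Fact fps_addA : associative fps_add.
Proof. by move=> f g h; apply/funext => m; apply: addrA. Qed.
Fact fps_addC : commutative fps_add.
Proof. by move=> f g; apply/funext => m; apply: addrC. Qed.
Fact fps_add0 : left_id (fpsC 0) fps_add.
Proof. by move=> f; apply/funext => m; rewrite /fps_add /fpsC mul0rn add0r. Qed.
Fact fps_addN : left_inverse (fpsC 0) fps_opp fps_add.
Proof. by move=> f; apply/funext => m; rewrite /fpsC mul0rn; apply: addNr. Qed.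

HB.instance Definition _ :=
  GRing.isZmodule.Build fps fps_addA fps_addC fps_add0 fps_addN.

Definition mdivides d m := all (fun i => d i <= m i)%N (finsupp d).

Lemma mdividesP d m : reflect (forall i, d i <= m i)%N (mdivides d m).
Proof.
apply: (iffP allP) => [H i|H i _]; last exact: H.
by case: (mdomP d i) => [/H|].
Qed.

Lemma mdividesK d m : mdivides d m -> mmul d (divcm m d) = m.
Proof.
by move/mdividesP => H; apply/eqP/cmP => i; rewrite cmM divcmE subnKC.
Qed.

Lemma mdividesMl d m : mdivides d (mmul d m).
Proof. by apply/mdividesP => i; rewrite cmM leq_addr. Qed.

Lemma divcmMl d m : divcm (mmul d m) d = m.
Proof. by apply/eqP/cmP => i; rewrite divcmE cmM addKn. Qed.

Lemma mulcmI d : injective (mmul d).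
Proof. by move=> m m' e; rewrite -(divcmMl d m) e divcmMl. Qed.

Definition mbelow m (s : {ffun finsupp m -> 'I_(mdeg m).+1}) : {cmonom nat} :=
  [cmonom val (s i) | i : finsupp m]%M.

(* the divisors of m *)
Definition mdivs m : {fset {cmonom nat}} :=
  [fset d in codom (@mbelow m) | mdivides d m]%fset.

Lemma mdivsP d m : (d \in mdivs m) = mdivides d m.
Proof.
rewrite !inE /=; apply: andb_idl => dm; apply/codomP.
exists [ffun i : finsupp m => inord (d (val i))].
apply/eqP/cmP => i; rewrite cmE fsfun_ffun.
case: insubP => [u _ <-|].
  rewrite /= ffunE inordK // ltnS (leq_trans (mdividesP _ _ dm _)) //.
  by rewrite mdegE (big_fsetD1 (val u)) ?(valP u) //= leq_addr.
rewrite -cmE_eq0 => /eqP m0.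
by have := mdividesP _ _ dm i; rewrite m0 leqn0 => /eqP.
Qed.

Definition fps_mul f g : fps := fun m => \sum_(d <- mdivs m) f d * g (divcm m d).

Fact fps_mulC : commutative fps_mul.
Proof.
move=> f g; apply/funext => m; rewrite /fps_mul.
have sub d : mdivides d m -> mdivides (divcm m d) m.
  by move=> _; apply/mdividesP => i; rewrite divcmE leq_subr.
have invo d : mdivides d m -> divcm m (divcm m d) = d.
  move/mdividesP => dm; apply/eqP/cmP => i.
  by rewrite !divcmE subKn.
have P : perm_eq (mdivs m) [seq divcm m d | d <- mdivs m].
  apply: uniq_perm; first exact: fset_uniq.
    rewrite map_inj_in_uniq ?fset_uniq // => d1 d2; rewrite !mdivsP => h1 h2 e.
    by rewrite -(invo d1) // e invo.
  move=> d; apply/idP/mapP => [|[d' + ->]]; rewrite !mdivsP; last exact: sub.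
  by move=> dm; exists (divcm m d); rewrite ?mdivsP ?sub ?invo.
rewrite (perm_big _ P) big_map big_seq [RHS]big_seq; apply: eq_bigr => d.
by rewrite mdivsP => dm; rewrite invo // mulrC.
Qed.

Fact fps_mulA : associative fps_mul.
Proof.
move=> f g h; apply/funext => m; rewrite /fps_mul.
under [RHS]eq_bigr do rewrite mulr_suml.
have -> : \sum_(c <- mdivs m) \sum_(d <- mdivs c) f d * g (divcm c d) * h (divcm m c)
    = \sum_(c <- mdivs m) \sum_(d <- mdivs m | mdivides d c)
        f d * g (divcm c d) * h (divcm m c).
  rewrite big_seq [RHS]big_seq; apply: eq_bigr => c; rewrite mdivsP => cm.
  rewrite -[RHS]big_filter; apply: perm_big; apply: uniq_perm => //.
  - by rewrite filter_uniq.
  move=> d; rewrite mem_filter !mdivsP; symmetry; apply: andb_idr.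
  move=> /mdividesP dc; apply/mdividesP => i.
  by apply: leq_trans (dc i) _; apply/mdividesP.
rewrite (exchange_big_dep xpredT) //= big_seq [RHS]big_seq.
apply: eq_bigr => d; rewrite mdivsP => dm; rewrite mulr_sumr -[RHS]big_filter.
have P : perm_eq [seq c <- mdivs m | mdivides d c]
                 [seq mmul d c | c <- mdivs (divcm m d)].
  apply: uniq_perm; first by rewrite filter_uniq ?fset_uniq.
    by rewrite (map_inj_uniq (@mulcmI d)) fset_uniq.
  move=> c; rewrite mem_filter mdivsP; apply/andP/mapP.
    move=> [dc cm]; exists (divcm c d); last by rewrite mdividesK.
    rewrite mdivsP; apply/mdividesP => i; rewrite !divcmE leq_sub2r //.
    exact/mdividesP.
  move=> [c']; rewrite mdivsP => /mdividesP c'm ->; split.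
    exact: mdividesMl.
  apply/mdividesP => i; rewrite cmM -leq_subRL ?(mdividesP _ _ dm) //.
  by rewrite -divcmE.
rewrite (perm_big _ P) big_map; apply: eq_bigr => c _.
rewrite divcmMl mulrA; congr (_ * h _); apply/eqP/cmP => i.
by rewrite !divcmE cmM subnDA.
Qed.

Fact fps_mul1 : left_id (fpsC 1) fps_mul.
Proof.
move=> f; apply/funext => m; rewrite /fps_mul (big_fsetD1 mone) /=; last first.
  by rewrite mdivsP; apply/mdividesP => i; rewrite cm1.
rewrite {1}/fpsC eqxx mul1r big1_fset ?addr0.
  by congr f; apply/eqP/cmP => i; rewrite divcmE cm1 subn0.
by move=> d; rewrite in_fsetD1 /fpsC => /andP[/negbTE -> _] _; rewrite mul0r.
Qed.

Fact fps_mulDl : left_distributive fps_mul fps_add.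
Proof.
move=> f g h; apply/funext => m; rewrite /fps_mul /fps_add -big_split /=.
by apply: eq_bigr => d _; rewrite mulrDl.
Qed.

Fact fps_oner_neq0 : fpsC 1 != 0.
Proof.
apply/eqP => e; have : fpsC 1 mone = fpsC 0 mone by rewrite e.
by rewrite /fpsC eqxx => /eqP; rewrite oner_eq0.
Qed.

HB.instance Definition _ := GRing.Zmodule_isComNzRing.Build fps
  fps_mulA fps_mulC fps_mul1 fps_mulDl fps_oner_neq0.

End FPS.

(* The elementary symmetric function e_i: the sum of all squarefree monomials *)
(* of degree i.                                                               *)
Definition elem (i : nat) : fps := fun m =>
  ((mdeg m == i) && all (fun j => m j <= 1)%N (finsupp m))%:R.

(* A polynomial in formal variables e_1, e_2, ... (index i standing for       *)
(* e_{i+1}) as a symmetric function.  The monomials of p correspond to the    *)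
(* products e_lambda, and its coefficients p@_m to the coefficients in the    *)
(* elementary basis.                                                          *)
Notation epoly := {malg rat[{cmonom nat}]}.

Definition esubst : epoly -> fps :=
  mmap fpsC (fun m : {cmonom nat} => \prod_(i <- finsupp m) elem i.+1 ^+ m i).

Notation Qe := {fraction epoly}.

Definition ratQe (c : rat) : Qe := tofrac (c%:MP : epoly).

Definition eQ (i : nat) : Qe :=
  if i is j.+1 then tofrac (<< ucm j >> : epoly) else 1.

Section Operators.
Implicit Types (k : nat).

Definition Idx k := {t : k.-tuple nat | uniq t && all (leq 1) t}.
Definition Vsp k := {malg Qe[Idx k]}.

(* b_t; the junk value 0 is never used below, as t is always in Idx k there *)
Definition bvec k (t : k.-tuple nat) : Vsp k :=
  if insub t is Some sigma then << (sigma : Idx k) >> else 0.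

Definition empty_idx : Idx 0 := exist _ [tuple] isT.

Definition linext k l (F : Idx k -> Vsp l) (v : Vsp k) : Vsp l :=
  \sum_(sigma <- msupp v) v@_sigma *: F sigma.

Lemma linext_is_linear k l (F : Idx k -> Vsp l) : linear (linext F).
Proof.
have wide (v : Vsp k) (d : {fset Idx k}) : (msupp v `<=` d)%fset ->
    linext F v = \sum_(s <- d) v@_s *: F s.
  move=> le; rewrite /linext (big_fset_incl _ le) // => s _ /mcoeff_outdom ->.
  by rewrite scale0r.
move=> a u v; set d := (msupp u `|` msupp v `|` msupp (a *: u + v))%fset.
rewrite !(wide _ d); try by apply/fsubsetP => x xin; rewrite !in_fsetU xin ?orbT.
rewrite scaler_sumr -big_split /=; apply: eq_bigr => s _.
by rewrite mcoeffD mcoeffZ scalerDl scalerA.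
Qed.

HB.instance Definition _ k l (F : Idx k -> Vsp l) :=
  GRing.isLinear.Build Qe (Vsp k) (Vsp l) *:%R (linext F) (linext_is_linear F).

(* Entries of sigma being distinct, the index r' <> r is the same as          *)
(* the entry t = sigma_{r'} differing from sigma_r = y - 1.                   *)
Definition Acoef (y : nat) (sigma : seq nat) : rat :=
  if y == 1%N then \prod_(t <- sigma) ((t%:R - 1) / t%:R)
  else if y.-1 \in sigma then
    let s := y.-1 in
    (s%:R + 1) / s%:R *
      \prod_(t <- sigma | t != s) ((s%:R - t%:R + 1) / (s%:R - t%:R))
  else 0.

(* Acoef y sigma = 0 for y > max(sigma) + 1, so that the sum over all         *)
(* positive y not in sigma stops there.                                       *)
Definition Mop k : {linear Vsp k -> Vsp k.+1} :=
  linext (fun sigma : Idx k =>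
    \sum_(1 <= y < (\max_(t <- val sigma) t).+2 | y \notin val sigma)
      ratQe (Acoef y (val sigma)) *: bvec [tuple of rcons (val sigma) y]).

Definition Dop k : {linear Vsp k.+1 -> Vsp k} :=
  linext (fun sigma : Idx k.+1 =>
    let s1 := thead (val sigma) in
    (eQ s1 / eQ s1.-1) *: bvec [tuple of behead (val sigma)]).

(* The operators applied so far, composed, with the number s of vertices that *)
(* are currently marked.                                                      *)
Definition from_V0 := {s : nat & {linear Vsp 0 -> Vsp s}}.

Definition forget_oldest (F : from_V0) : from_V0 :=
  match F with
  | existT s.+1 f => existT _ s (Dop s \o f : {linear _ -> _})
  | existT 0 f => existT _ 0 f
  end.

Definition forget_to (r : nat) (F : from_V0) : from_V0 :=
  iter (tag F - r) forget_oldest F.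

(* In a natural unit interval graph the r smaller neighbours are always       *)
(* marked, i.e. r <= tag F, so that Mop is applied with s = r.                *)
Definition mark_new (r : nat) (F : from_V0) : from_V0 :=
  let: existT s f := forget_to r F in
  existT _ s.+1 (Mop s \o f : {linear _ -> _}).

Fixpoint forget_all (s : nat) : {linear Vsp s -> Vsp 0} :=
  if s is s'.+1 then (forget_all s' \o Dop s' : {linear _ -> _})
  else (idfun : {linear _ -> _}).

Definition scalar_of (f : {linear Vsp 0 -> Vsp 0}) : Qe :=
  (f << empty_idx >>)@_empty_idx.

End Operators.

Section Graphs.
Variable n : nat.
Implicit Types (e : rel 'I_n) (p q r u v : 'I_n).

(* The vertex i : 'I_n stands for i + 1. *)
Definition natural_unit_interval e :=
  forall p q r, e p q -> (p < r < q)%N -> e p r /\ e r q.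

Definition smaller_degree e v := #|[set u : 'I_n | (u < v)%N && e u v]|.

Definition MG e : Qe :=
  let: existT s f :=
    foldl (fun F v => mark_new (smaller_degree e v) F)
          (existT _ 0 (idfun : {linear Vsp 0 -> Vsp 0}) : from_V0) (enum 'I_n) in
  scalar_of (forget_all s \o f : {linear _ -> _}).

Definition proper e (kappa : 'I_n -> nat) :=
  [forall u, forall v, e u v ==> (kappa u != kappa v)].

(* The colour c : nat stands for the colour c + 1, so that it contributes the *)
(* variable of index c.  The coefficient of m counts the proper colourings    *)
(* kappa with monomial m; such a kappa only uses colours in finsupp m.        *)
Definition chromatic e : fps := fun m =>
  #|[set kappa : {ffun 'I_n -> finsupp m} |
      proper e (fun v => val (kappa v)) &&
      (\big[mmul/mone]_v ucm (val (kappa v)) == m)]|%:R.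

End Graphs.

(* Main.v *)
Require Import Defs.
From HB Require Import structures.
From mathcomp Require Import all_boot all_order all_algebra ring zify.
From mathcomp Require Import fraction boolp finmap monalg.

(* Colour the vertices in order and record the colours of the marked ones: if *)
(* y_1, ..., y_k are the variables of the marked colours, the partial sum of  *)
(* X_G is a polynomial in the y_i over the symmetric functions.  Adding a     *)
(* vertex multiplies it by a new y_{k+1}, and forgetting the oldest one       *)
(* replaces y_1 ^ a by p_a - y_2 ^ a - ... - y_k ^ a.  So it suffices to find *)
(* vectors T_a of V_k, one for each monomial y ^ a, with M T_a = T_(a, 1) and *)
(* D T_a = p_(a_1) T_(a_2, ..., a_k) - \sum_i T_(a_2, ..., a_i + a_1, ...).   *)
(* Since MD - DM identifies the oldest colour with the newest one, the T_a    *)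
(* are forced: appending 1 is M, and moving a_1 to the end while adding 1     *)
(* to it is MD - DM.  The law for D then follows by induction, using an       *)
(* action of the symmetric group on V_k compatible with M and D (as in        *)
(* Young's seminormal form) that permutes the exponents, down to the case     *)
(* k = 1, which is Newton's identity.                                         *)
(* For positivity, the factors e_s / e_(s - 1) telescope along columns of     *)
(* boxes: a vertex of height y > 1 is stacked on the marked vertex of height  *)
(* y - 1, and a column of final height h contributes e_h.                     *)

Set Implicit Arguments.
Unset Strict Implicit.
Unset Printing Implicit Defensive.

Import GRing.Theory.
Local Open Scope ring_scope.

(** * Newton's identities *)

(** Both sides are computed by one process, [outcome], under different readings of marking and
    forgetting a vertex; [outcome_rel] transfers a relation between two runs. The common value
    [chromatic_poly] is the run on formal combinations of monomials in the marked colours, with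
    coefficients in Q[e_1, e_2, ...].

    Colourings: the smaller neighbours of a vertex are the vertices just before it
    ([smaller_degreeP]), so marked vertices have distinct colours, and summing over the oldest
    colour is the rule of [unmark_terms] ([color_outcome], [chromatic_polyE]).

    Operators: let C = MD - DM and let S be a seminormal transposition of adjacent entries. The
    rational identities [append_coef_braid], [merge_coef_braid] and [merge_coef_swap] give S M M = M
    M, S M C = C M and D C = C D S, whence S C C = C C S; on the left of an equation S acts on the
    two newest entries, on the right on the two oldest. Hence S permutes the exponents of T_a
    ([monomial_swap]), and D obeys the same forgetting rule ([monomial_unmark]), so
    [MG_chromatic_poly] holds.

    Positivity: the coefficients A are nonnegative, and weighting b_sigma by [column_weight] clears
    the denominators of D; M and D both preserve positivity of the weighted values ([positive_mark],
    [positive_unmark]). As Q[e_1, e_2, ...] embeds in its fraction field, the positive polynomial so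
    obtained is [chromatic_poly]. *)

Section Newton.
Variables (R : comNzRingType) (e : nat -> R).

Definition newton_sum (u : nat -> R) i := \sum_(j < i.+1) (-1) ^+ j * e (i - j) * u j.

(** The system is triangular with diagonal entries (-1)^i e_0, which are invertible. *)
Lemma newton_sum_inj u v : e 0 = 1 -> newton_sum u =1 newton_sum v -> u =1 v.
Proof.
move=> e0 uv; elim/ltn_ind => i IHi; have := uv i.
rewrite /newton_sum !big_ord_recr /= subnn e0 mulr1.
rewrite (eq_bigr (fun j : 'I_i => (-1) ^+ j * e (i - j) * v j)) => [/addrI|j _].
  by move/(congr1 (fun a => (-1) ^+ i * a)); rewrite !signrMK.
by rewrite IHi.
Qed.

(** Newton's identities solved recursively for the power sums: no division occurs, so these are
    polynomials in the e_i over any commutative ring. *)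
Fixpoint power_sums n : seq R :=
  if n is n'.+1 then
    let l := power_sums n' in
    rcons l ((-1) ^+ n' * (n'.+1%:R * e n'.+1 -
      \sum_(j < n') (-1) ^+ j * e (n' - j) * l`_j))
  else [::].

(* This is p_(j + 1). *)
Definition power_sum j := (power_sums j.+1)`_j.

Lemma size_power_sums n : size (power_sums n) = n.
Proof. by elim: n => //= n IHn; rewrite size_rcons IHn. Qed.

Lemma nth_power_sums n j : (j < n)%N -> (power_sums n)`_j = power_sum j.
Proof.
elim: n => // n IHn; rewrite ltnS leq_eqVlt => /orP[/eqP-> //|lt_jn].
by rewrite /= nth_rcons size_power_sums lt_jn IHn.
Qed.

Lemma power_sumP i : e 0 = 1 -> newton_sum power_sum i = i.+1%:R * e i.+1.
Proof.
move=> e0; rewrite /newton_sum big_ord_recr /= subnn e0 mulr1 {2}/power_sum /=.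
rewrite nth_rcons size_power_sums ltnn eqxx signrMK.
by under [X in _ + (_ - X)]eq_bigr do rewrite nth_power_sums //; rewrite addrC subrK.
Qed.

End Newton.

Section ElementarySymmetric.
Variables (R : comNzRingType) (x : nat -> R).

Fixpoint esym (s : seq nat) i : R :=
  if s is z :: s' then
    esym s' i + x z * (if i is i'.+1 then esym s' i' else 0)
  else (i == 0%N)%:R.

Lemma esym0 s : esym s 0 = 1.
Proof. by elim: s => //= z s ->; rewrite mulr0 addr0. Qed.

(** Adding a variable x_z turns e_i into e_i + x_z e_(i-1) and adds a power of x_z to each power
    sum; the sums involving the new powers telescope to x_z e_i. *)
Lemma esym_newton s i :
  newton_sum (esym s) (fun j => \sum_(z <- s) x z ^+ j.+1) i = i.+1%:R * esym s i.+1.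
Proof.
elim: s i => [|z s IHs] i /=.
  by rewrite mulr0 /newton_sum big1 // => j _; rewrite big_nil mulr0.
pose E k := if k is k'.+1 then esym s k' else 0.
pose P j := \sum_(z <- s) x z ^+ j.+1.
have old : \sum_(j < i.+1) (-1) ^+ j * esym s (i - j)%N * P j = i.+1%:R * esym s i.+1.
  exact: IHs.
have shift : \sum_(j < i.+1) (-1) ^+ j * E (i - j)%N * P j = i%:R * esym s i.
  case: i {old} => [|i]; first by rewrite big_ord1 mulr0 !mul0r.
  rewrite big_ord_recr /= subnn mulr0 mul0r addr0 -IHs; apply: eq_bigr => j _.
  by rewrite subSn // -ltnS.
have tele : \sum_(j < i.+1) (-1) ^+ j * esym s (i - j)%N * x z ^+ j.+1
    + \sum_(j < i.+1) (-1) ^+ j * E (i - j)%N * x z ^+ j.+2 = x z * esym s i.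
  rewrite big_ord_recl [X in _ + X]big_ord_recr /= subnn mulr0 mul0r addr0 subn0.
  rewrite expr0 mul1r expr1 mulrC -addrA -big_split /= big1 ?addr0 // => j _.
  rewrite /bump /= add1n exprS subnS; have : (0 < i - j)%N by rewrite subn_gt0.
  by case: (i - j)%N => //= k _; rewrite mulN1r !mulNr addNr.
transitivity (\sum_(j < i.+1) (((-1) ^+ j * esym s (i - j)%N * P j
    + x z * ((-1) ^+ j * E (i - j)%N * P j))
    + ((-1) ^+ j * esym s (i - j)%N * x z ^+ j.+1 + (-1) ^+ j * E (i - j)%N * x z ^+ j.+2))).
  apply: eq_bigr => j _ /=; rewrite big_cons -/(P j) -/(E (i - j)%N) !exprS.
  by move: (_ ^+ j) (x z ^+ j) => u v; ring.
rewrite !big_split /= -mulr_sumr tele old shift -[i.+1%:R]natr1; ring.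
Qed.

End ElementarySymmetric.

(** * The coefficients of M *)

Section Coefficients.
Variable K : fieldType.
Hypothesis natK_neq0 : forall n, n.+1%:R != 0 :> K.
Implicit Types (s t : seq nat) (c d x y z : nat).

Lemma natK_eq x y : (x%:R == y%:R :> K) = (x == y).
Proof.
wlog le_xy : x y / (x <= y)%N.
  by move=> H; case/orP: (leq_total x y) => /H // E; rewrite eq_sym E eq_sym.
rewrite -(subnK le_xy); case: (y - x)%N => [|k]; first by rewrite !eqxx.
rewrite natrD -subr_eq0 opprD addrCA subrr addr0 oppr_eq0.
by rewrite (negbTE (natK_neq0 k)) addSn eq_sym gtn_eqF // ltnS leq_addl.
Qed.

Lemma subK_neq0 x y : x != y -> x%:R - y%:R != 0 :> K.
Proof. by rewrite subr_eq0 natK_eq. Qed.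

Lemma subK1_neq0 x y : x != y.+1 -> x%:R - y%:R - 1 != 0 :> K.
Proof. by move=> /subK_neq0; rewrite -natr1 opprD addrA. Qed.

Definition good s := uniq s && all (leq 1) s.

Definition append_coef y s : K :=
  if y == 1%N then \prod_(x <- s) ((x%:R - 1) / x%:R)
  else if y.-1 \in s then
    (y.-1%:R + 1) / y.-1%:R *
      \prod_(x <- s | x != y.-1) ((y.-1%:R - x%:R + 1) / (y.-1%:R - x%:R))
  else 0.
Local Notation A := append_coef.

Lemma good_cons x s : good (x :: s) = [&& (0 < x)%N, x \notin s & good s].
Proof. by rewrite /good /= andbACA andbC -!andbA; do !bool_congr. Qed.

Lemma good_perm s t : perm_eq s t -> good s = good t.
Proof. by move=> e; rewrite /good (perm_uniq e) (perm_all _ e). Qed.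

Lemma good_rcons s x : good (rcons s x) = [&& (0 < x)%N, x \notin s & good s].
Proof. by rewrite (good_perm (t := x :: s)) ?perm_rcons // good_cons. Qed.

Lemma append_coef_perm y s t : perm_eq s t -> A y s = A y t.
Proof.
by move=> e; rewrite /A (perm_mem e); do ?case: ifP => // _; do ?congr (_ * _); apply: perm_big.
Qed.

Lemma append_coef_rcons y s x : A y (rcons s x) = A y (x :: s).
Proof. by apply: append_coef_perm; rewrite perm_rcons. Qed.

Lemma append_coefC y s c d : A y (c :: d :: s) = A y (d :: c :: s).
Proof. exact/append_coef_perm/permPl/(perm_catCA [:: c] [:: d] s). Qed.

(** A is a product over the entries, so a new entry contributes one factor. Its pole z = c + 1 is
    the case where c itself makes the coefficient nonzero. *)
Lemma append_coef_cons z c s : (0 < c)%N -> c \notin s -> (0 < z)%N -> z != c.+1 ->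
  A z (c :: s) = A z s * ((z%:R - c%:R) / (z%:R - c%:R - 1)).
Proof.
move=> c0 cs z0 nz; have c0K : c%:R != 0 :> K by rewrite -[0]/(0%:R) natK_eq -lt0n.
rewrite /A; case: eqP => [->|/eqP n1].
  rewrite big_cons mulrC; congr (_ * _).
  have -> : (1 : K) - c%:R - 1 = - c%:R by ring.
  by rewrite invrN mulrN -mulNr opprB.
have nzc : (z.-1 == c) = false.
  by apply: contraNF nz; case: (z) => [|k] /= /eqP e; [rewrite -e in c0 | rewrite e].
rewrite inE nzc /=; case: ifP => [zs|_]; last by rewrite mul0r.
rewrite big_cons eq_sym nzc /= -[RHS]mulrA; congr (_ * _); rewrite mulrC; congr (_ * _).
have -> : z%:R = z.-1%:R + 1 :> K by rewrite natr1 prednK.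
by congr (_ / _); ring.
Qed.

Lemma append_coef_eq0 z s : z != 1%N -> z.-1 \notin s -> A z s = 0.
Proof. by rewrite /A => /negbTE -> /negbTE ->. Qed.

Lemma append_coef_succ c s : (0 < c)%N -> c \notin s -> A c.+1 s = 0.
Proof. by move=> c0 cs; apply: append_coef_eq0; rewrite // eqSS -lt0n. Qed.

(** One factor of the product vanishes. This is why [mark] can sum over all y, where M only takes y
    outside sigma. *)
Lemma append_coef_mem y s : good s -> y \in s -> A y s = 0.
Proof.
move=> gs ys; have [t e] : exists t, perm_eq s (y :: t).
  by exists (rem y s); apply: perm_to_rem.
rewrite (append_coef_perm _ e); move: gs; rewrite (good_perm e) good_cons => /and3P[y0 yt _].
by rewrite append_coef_cons ?subrr ?mul0r ?mulr0 // ltn_eqF.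
Qed.

Lemma append_coef0 s : good s -> A 0 s = 0.
Proof.
by case/andP=> _ h; apply: append_coef_eq0 => //=; apply/negP => /(allP h).
Qed.

Lemma append_coef_bad y s : good s -> (y == 0%N) || (y \in s) -> A y s = 0.
Proof. by move=> gs /orP[/eqP ->|]; [apply: append_coef0|apply: append_coef_mem]. Qed.

Lemma good_consN y s : good s -> good (y :: s) = ~~ ((y == 0%N) || (y \in s)).
Proof. by move=> gs; rewrite good_cons gs andbT negb_or lt0n. Qed.

Lemma good_cons2 c y s : good (c :: s) -> good (y :: s) -> y != c -> good [:: c, y & s].
Proof.
move=> gcs gys nyc; rewrite good_cons gys andbT inE negb_or eq_sym nyc.
by move: gcs; rewrite good_cons => /and3P[-> ->].
Qed.

(* [C = M D - D M] maps [b_(c :: s)] to the sum over y of                     *)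
(* [q_c * merge_coef c s y *: b_(rcons s y)].                                 *)
Definition merge_coef c s y := A y s - A y (c :: s).
Local Notation g := merge_coef.

(** One coefficient of S M C = C M. Generically [append_coef_cons] reduces it to an identity of
    rational functions; the cases are the zeros and poles, where y or z is c or c + 1, or y and z
    differ by one. *)
Lemma merge_coef_braid c s y z : good (c :: s) -> good (y :: s) -> good (z :: s) ->
  y != z ->
  g c s y * A z (y :: s) / (z%:R - y%:R)
    + g c s z * A y (z :: s) * (1 - (y%:R - z%:R)^-1)
  = A y (c :: s) * g c (y :: s) z.
Proof.
move=> gcs gys gzs nyz.
have [/and3P[c0 cs gs] /and3P[y0 ys _] /and3P[z0 zs _]] :
  [/\ [&& (0 < c)%N, c \notin s & good s], [&& (0 < y)%N, y \notin s & good s]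
    & [&& (0 < z)%N, z \notin s & good s]] by rewrite -!good_cons.
have nzy : z != y by rewrite eq_sym.
have dyz := subK_neq0 nyz; have dzy := subK_neq0 nzy.
have succ0 x : (0 < x)%N -> x \notin s -> A x.+1 s = 0 by exact: append_coef_succ.
have succB x : x.+1%:R - x%:R = 1 :> K by rewrite -natr1 addrAC subrr add0r.
have n_succ x : x != x.+1 by rewrite ltn_eqF.
have n_succ2 x : x != x.+2 by rewrite ltn_eqF // ltnW.
rewrite /g; have [yc|nyc] := eqVneq y c.
  subst c; rewrite (append_coef_mem gys) ?mem_head // subr0 mul0r.
  have [zy|nzy1] := eqVneq z y.+1.
    subst z; rewrite succ0 // sub0r (append_coef_cons (z := y)) //.
    move: (A _ _) (A _ _) => u v; rewrite -natr1; field.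
    by rewrite !natr1 subK1_neq0 ?subK_neq0.
  have [yz|nyz1] := eqVneq y z.+1.
    subst y; rewrite (succ0 z) // !mul0r add0r succB.
    by rewrite invr1 subrr mulr0.
  rewrite !(append_coef_cons (s := s)) //; field.
  by rewrite !subK1_neq0 ?subK_neq0.
have ncy : c \notin y :: s by rewrite inE negb_or eq_sym nyc.
have [zc|nzc] := eqVneq z c.
  subst z; have gcys : good [:: c, y & s] by rewrite good_cons c0 ncy.
  rewrite (append_coef_mem (y := c) gcys) ?mem_head //.
  rewrite (append_coef_mem (y := c) gcs) ?mem_head // !subr0.
  have [yc|nyc1] := eqVneq y c.+1.
    subst y; rewrite (succ0 c) // (append_coef_cons (z := c)) //.
    move: (A _ _) (A _ _) => u v; rewrite -natr1; field.
    by rewrite !natr1 subK1_neq0 ?subK_neq0.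
  have [cy|ncy1] := eqVneq c y.+1.
    subst c; rewrite (succ0 y) // (append_coef_cons (z := y)) //.
    move: (A _ _) (A _ _) => u v; rewrite -natr1; field.
    by rewrite !natr1 subK1_neq0 ?subK_neq0.
  rewrite !(append_coef_cons (s := s)) //; field.
  by rewrite !subK1_neq0 ?subK_neq0.
have ncz : c \notin z :: s by rewrite inE negb_or eq_sym nzc.
have [yc|nyc1] := eqVneq y c.+1.
  subst y; rewrite (succ0 c) // (append_coef_cons (z := z) (s := c.+1 :: s)) //.
  rewrite (append_coef_succ (c := c) (s := z :: s)) //.
  move: dzy; rewrite -natr1 opprD addrA => dzy.
  move: (A _ _) (A _ _) (A _ _) (A _ _) => u v w t; field.
  by rewrite dzy natr1.
have [zc|nzc1] := eqVneq z c.+1.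
  have yscs : y \notin c :: s by rewrite inE negb_or nyc.
  have ncyS : c.+1 != y.+1 by rewrite eqSS eq_sym.
  subst z; rewrite append_coefC (append_coef_cons (c := y) (s := c :: s)) //.
  rewrite (append_coef_succ (c := c) (s := y :: s)) // (succ0 c) //.
  have [yc2|nyc2] := eqVneq y c.+2.
    subst y; rewrite (append_coef_cons (c := c) (s := s)) // (succ0 c.+1) //.
    by rewrite succB invr1 subrr !(mulr0, mul0r) addr0.
  rewrite (append_coef_cons (z := y) (c := c)) // (append_coef_cons (z := y) (c := c.+1)) //.
  move: (A _ _) (A _ _) => u v; rewrite -natr1; field.
  by rewrite !natr1 !subK1_neq0 ?subK_neq0.
rewrite (append_coef_cons (c := c) (s := y :: s)) // !(append_coef_cons (c := c) (s := s)) //.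
have [zy|nzy1] := eqVneq z y.+1.
  subst z; rewrite (succ0 y) // !mul0r subrr !mul0r addr0.
  move: (A _ _) (A _ _) => u v; rewrite -natr1; field.
  by rewrite !natr1 !subK1_neq0 ?subK_neq0.
have [yz|nyz1] := eqVneq y z.+1.
  subst y; rewrite (succ0 z) // !mul0r subrr !mul0r add0r succB.
  by rewrite invr1 subrr mulr0.
rewrite !(append_coef_cons (s := s)) //; field.
by rewrite !subK1_neq0 ?subK_neq0.
Qed.

(** One coefficient of S M M = M M. *)
Lemma append_coef_braid s y z : good (y :: s) -> good (z :: s) -> y != z ->
  A y s * A z (y :: s) / (z%:R - y%:R)
    + A z s * A y (z :: s) * (1 - (y%:R - z%:R)^-1)
  = A y s * A z (y :: s).
Proof.
rewrite !good_cons => /and3P[y0 ys gs] /and3P[z0 zs _] nyz.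
have succB x : x.+1%:R - x%:R = 1 :> K by rewrite -natr1 addrAC subrr add0r.
have nzy : z != y by rewrite eq_sym.
have [zy|nzy1] := eqVneq z y.+1.
  by subst z; rewrite (append_coef_succ (c := y) (s := s)) // !mul0r succB divr1 addr0.
have [yz|nyz1] := eqVneq y z.+1.
  by subst y; rewrite (append_coef_succ (c := z) (s := s)) // !mul0r succB invr1 subrr mulr0 addr0.
rewrite !append_coef_cons //; field.
by rewrite !subK1_neq0 ?subK_neq0.
Qed.

Lemma merge_coef_eq0 c s y : good (c :: s) -> (y == 0%N) || (y \in s) -> g c s y = 0.
Proof.
move=> gcs; have : good s by move: gcs; rewrite good_cons => /and3P[].
move=> gs /orP[/eqP ->|ys]; first by rewrite /g !append_coef0 ?subrr.
by rewrite /g !append_coef_mem ?subrr // inE ys orbT.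
Qed.

(** One coefficient of D C = C D S. *)
Lemma merge_coef_swap c d s y : good [:: c, d & s] ->
  g c (d :: s) y
  = (d%:R - c%:R)^-1 * g d s y + (1 - (d%:R - c%:R)^-1) * g c s y.
Proof.
move=> gcds; have gdcs : good [:: d, c & s].
  by rewrite -(good_perm (s := [:: c, d & s])) //; apply/permPl/(perm_catCA [:: c] [:: d] s).
move: (gcds) (gdcs); rewrite !good_cons => /and3P[c0 + /and3P[d0 ds gs]] /and3P[_ + /and3P[_ cs _]].
move=> cds dcs; have gds : good (d :: s) by rewrite good_cons d0 ds.
have gcs : good (c :: s) by rewrite good_cons c0 cs.
have [y0|/norP[y0 ys]] := boolP ((y == 0%N) || (y \in s)).
  by rewrite !merge_coef_eq0 ?mulr0 ?addr0 // inE; case/orP: y0 => ->; rewrite ?orbT.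
rewrite -lt0n in y0.
have ncd : c != d by move: cds; rewrite inE negb_or => /andP[].
have ndc : d != c by rewrite eq_sym.
have succB x : x.+1%:R - x%:R = 1 :> K by rewrite -natr1 addrAC subrr add0r.
have n_succ x : x != x.+1 by rewrite ltn_eqF.
have succ0 x : (0 < x)%N -> x \notin s -> A x.+1 s = 0 by exact: append_coef_succ.
rewrite /g; have [yd|nyd] := eqVneq y d.
  subst y; rewrite (append_coef_mem (y := d) gcds) ?inE ?eqxx ?orbT //.
  rewrite (append_coef_mem (y := d) gds) ?mem_head // !subr0.
  have [dc|ndc1] := eqVneq d c.+1.
    by subst d; rewrite succ0 // succB invr1 !subrr mulr0 mul0r addr0.
  rewrite append_coef_cons //; field.
  by rewrite !subK1_neq0 ?subK_neq0.
have [yc|nyc] := eqVneq y c.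
  subst y; rewrite (append_coef_mem (y := c) gcds) ?mem_head //.
  rewrite (append_coef_mem (y := c) gcs) ?mem_head // !subr0.
  have [cd|ncd1] := eqVneq c d.+1.
    subst c; rewrite succ0 // -natr1; move: (A _ _) => u; field.
    by rewrite !natr1 ?subK_neq0.
  rewrite append_coef_cons //; field.
  by rewrite !subK1_neq0 ?subK_neq0.
have [yc1|nyc1] := eqVneq y c.+1.
  subst y; rewrite append_coefC (append_coef_cons (s := c :: s)) //.
  rewrite (append_coef_cons (s := s) (c := d)) // succ0 //.
  move: (A _ _) => u; rewrite -natr1; field.
  by rewrite !natr1 !subK1_neq0 ?subK_neq0.
rewrite (append_coef_cons (s := d :: s)) // (append_coef_cons (s := s) (c := c)) //.
have [yd1|nyd1] := eqVneq y d.+1.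
  subst y; rewrite succ0 //.
  move: (A _ _) => u; rewrite -natr1; field.
  by rewrite !natr1 !subK1_neq0 ?subK_neq0.
rewrite append_coef_cons //; field.
by rewrite !subK1_neq0 ?subK_neq0.
Qed.

(** * Functionals on V_k *)

Variable q : nat -> K.
Implicit Types (i k N : nat) (phi psi : seq nat -> K).

(* A functional on V_k is given by its values phi s at the b_s.  Transposes   *)
(* of operators act on functionals: [mark], [unmark] and [merge] are those of *)
(* M, D and MD - DM, hence compose in the opposite order.  The transpose      *)
(* [swap i] of an adjacent transposition has the coefficients of Young's      *)
(* seminormal form.                                                           *)
Definition mark phi s : K :=
  \sum_(1 <= y < (\max_(t <- s) t).+2) A y s * phi (rcons s y).

Definition unmark phi s : K := if s is c :: s' then q c * phi s' else 0.

Definition merge phi s : K := unmark (mark phi) s - mark (unmark phi) s.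

Definition swap i phi s : K :=
  let x := nth 0%N s i in let y := nth 0%N s i.+1 in
  (y%:R - x%:R)^-1 * phi s +
  (1 - (y%:R - x%:R)^-1) * phi (take i s ++ [:: y, x & drop i.+2 s]).

(* Under [room k N s], the entries added by k successive marks stay below N,  *)
(* so that sums over them can all range over 'I_N.                            *)
Definition room k N s := (k < N)%N && all (fun x => x + k < N)%N s.

Lemma room_exists k s : exists N, room k N s.
Proof.
exists (\max_(x <- s) x + k).+1; rewrite /room ltnS leq_addl /=.
apply/allP => x xs; rewrite ltnS leq_add2r.
exact: (leq_bigmax_seq (F := id) x xs).
Qed.

Lemma room_le k N s : room k.+1 N s -> room k N s.
Proof.
case/andP=> kN /allP h; rewrite /room ltnW //=; apply/allP => x /h.
by rewrite addnS; apply: ltnW.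
Qed.

(** A nonzero coefficient forces y = 1 or y - 1 in s, so one mark raises the maximum by at most
    one. *)
Lemma room_rcons k N s y : A y s != 0 -> room k.+1 N s -> room k N (rcons s y).
Proof.
move=> Ay rs; have := room_le rs; rewrite /room all_rcons => /andP[-> ->] /=.
rewrite andbT; case/andP: rs => kN /allP h.
have [->|y1] := eqVneq y 1%N; first by rewrite add1n.
have: y.-1 \in s by apply: contraNT Ay => ?; rewrite append_coef_eq0.
by move/h; apply: leq_ltn_trans; rewrite addnS -addSn leq_add2r leqSpred.
Qed.

Lemma mark_room phi s N : good s -> room 1 N s ->
  mark phi s = \sum_(y < N) A y s * phi (rcons s y).
Proof.
move=> gs /andP[N1 /allP h]; rewrite -(big_mkord xpredT (fun y => A y s * phi (rcons s y))).
have maxN : ((\max_(t <- s) t).+2 <= N)%N.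
  case: N N1 h => [|[|N]] // _ h; rewrite !ltnS; apply/bigmax_leqP_seq => x /h.
  by rewrite addn1 !ltnS.
rewrite (big_cat_nat (n := (\max_(t <- s) t).+2)) //= big_ltn // append_coef0 // mul0r add0r.
rewrite [X in _ + X]big_nat_cond [X in _ + X]big1 ?addr0 // => y /andP[/andP[lt_y _] _].
rewrite append_coef_eq0 ?mul0r //; first by case: y lt_y => [|[]].
apply: contraL lt_y => ys; rewrite -ltnNge !ltnS.
by apply: leq_trans (leqSpred y) _; rewrite ltnS (leq_bigmax_seq (F := id) _ ys).
Qed.

Lemma eq_mark phi psi s : good s ->
  (forall y, (0 < y)%N -> y \notin s -> phi (rcons s y) = psi (rcons s y)) ->
  mark phi s = mark psi s.
Proof.
move=> gs e; apply: eq_big_nat => y /andP[y0 _].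
by have [ys|/e->//] := boolP (y \in s); rewrite append_coef_mem ?mul0r.
Qed.

Lemma merge_room phi c s N : good (c :: s) -> room 1 N (c :: s) ->
  merge phi (c :: s) = q c * \sum_(y < N) g c s y * phi (rcons s y).
Proof.
move=> gcs rcs; have gs : good s by move: gcs; rewrite good_cons => /and3P[].
have rs : room 1 N s by move: rcs => /andP[N1 /= /andP[_ h]]; apply/andP.
rewrite /merge /= (mark_room _ gs rs) (mark_room _ gcs rcs) !mulr_sumr -sumrB.
by apply: eq_bigr => y _ /=; rewrite mulrBl mulrBr [A y (c :: s) * _]mulrCA.
Qed.

Lemma eq_merge phi psi c s : good (c :: s) ->
  (forall y, (0 < y)%N -> y \notin s -> phi (rcons s y) = psi (rcons s y)) ->
  merge phi (c :: s) = merge psi (c :: s).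
Proof.
move=> gcs e; have [N r] := room_exists 1 (c :: s).
rewrite !(merge_room _ gcs r); congr (_ * _); apply: eq_bigr => y _.
have [y0|/norP[y0 ys]] := boolP ((y == 0%N :> nat) || (val y \in s)).
  by rewrite merge_coef_eq0 ?mul0r.
by rewrite e ?lt0n.
Qed.

Lemma markB phi psi s : mark (fun t => phi t - psi t) s = mark phi s - mark psi s.
Proof. by rewrite /mark -sumrB; apply: eq_bigr => y _; rewrite mulrBr. Qed.

Lemma unmarkB phi psi s :
  unmark (fun t => phi t - psi t) s = unmark phi s - unmark psi s.
Proof. by case: s => [|c s] /=; rewrite ?subr0 ?mulrBr. Qed.

Lemma mergeB phi psi s :
  merge (fun t => phi t - psi t) s = merge phi s - merge psi s.
Proof.
rewrite /merge; have -> : mark (unmark (fun t => phi t - psi t)) s =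
  mark (fun t => unmark phi t - unmark psi t) s.
  by apply: eq_bigr => y _; rewrite unmarkB.
have -> : unmark (mark (fun t => phi t - psi t)) s =
  unmark (fun t => mark phi t - mark psi t) s by case: s => //= c s; rewrite markB.
by rewrite markB unmarkB; ring.
Qed.

Lemma swapB i phi psi s :
  swap i (fun t => phi t - psi t) s = swap i phi s - swap i psi s.
Proof. by rewrite /swap /=; ring. Qed.

Lemma swap_cat t1 x y t2 phi :
  swap (size t1) phi (t1 ++ [:: x, y & t2]) =
  (y%:R - x%:R)^-1 * phi (t1 ++ [:: x, y & t2]) +
  (1 - (y%:R - x%:R)^-1) * phi (t1 ++ [:: y, x & t2]).
Proof.
rewrite /swap !nth_cat ltnn subnn ltnNge leqnSn /= subSnn /= take_size_cat //.
by rewrite drop_cat ltnNge ltnW //= -addn2 addKn /= drop0.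
Qed.

Lemma swap_split s i : (i.+1 < size s)%N ->
  exists t1 x y t2, s = t1 ++ [:: x, y & t2] /\ i = size t1.
Proof.
move=> lt; exists (take i s), (nth 0%N s i), (nth 0%N s i.+1), (drop i.+2 s).
by rewrite -!drop_nth ?cat_take_drop ?size_takel // ltnW // ltnW.
Qed.

Lemma perm_swap t1 x y t2 :
  perm_eq (t1 ++ [:: x, y & t2]) (t1 ++ [:: y, x & t2] : seq nat).
Proof. by rewrite perm_cat2l; apply/permPl/(perm_catCA [:: x] [:: y] t2). Qed.

(** M appends at the end with coefficients symmetric in the old entries. *)
Lemma mark_swap i phi s : good s -> (i.+1 < size s)%N ->
  mark (swap i phi) s = swap i (mark phi) s.
Proof.
move=> gs /swap_split[t1 [x [y [t2 [e ->]]]]]; subst s.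
have p := perm_swap t1 x y t2.
have [N r] := room_exists 1 (t1 ++ [:: x, y & t2]).
have r' : room 1 N (t1 ++ [:: y, x & t2]) by move: r; rewrite /room (perm_all _ p).
rewrite swap_cat !(@mark_room _ _ N) ?(good_perm p) -?(good_perm p) //.
rewrite !mulr_sumr -big_split; apply: eq_bigr => z _ /=.
rewrite -(append_coef_perm _ p) !rcons_cat /= swap_cat; ring.
Qed.

Lemma unmark_swap i phi c s :
  unmark (swap i phi) (c :: s) = swap i.+1 (unmark phi) (c :: s).
Proof. by rewrite /swap /= mulrDr; congr (_ + _); rewrite mulrCA. Qed.

(** With d = y - x, this is 1/d^2 + (1 - 1/d)(1 + 1/d) = 1, the mixed terms cancelling. *)
Lemma swapK i phi s : good s -> (i.+1 < size s)%N -> swap i (swap i phi) s = phi s.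
Proof.
move=> gs /swap_split[t1 [x [y [t2 [e ->]]]]]; subst s; rewrite !swap_cat.
have nxy : x != y.
  apply/eqP => e; move: gs; rewrite /good e cat_uniq /= inE eqxx /=.
  by rewrite !andbF.
have nyx : y != x by rewrite eq_sym.
field; by rewrite !subK_neq0.
Qed.

Lemma mark_mark_room phi s N : good s -> room 2 N s ->
  mark (mark phi) s =
  \sum_(y < N) \sum_(z < N) A y s * A z ((y : nat) :: s) * phi (rcons (rcons s y) z).
Proof.
move=> gs rs; rewrite (mark_room _ gs (room_le rs)); apply: eq_bigr => y _.
have [->|Ay] := eqVneq (A y s) 0.
  by rewrite mul0r big1 // => z _; rewrite !mul0r.
have gsy : good (rcons s y).
  rewrite good_rcons gs andbT lt0n -negb_or; apply: contraNN Ay => yb.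
  by rewrite append_coef_bad.
rewrite (mark_room _ gsy (room_rcons Ay rs)) mulr_sumr; apply: eq_bigr => z _.
by rewrite append_coef_rcons mulrA.
Qed.

Lemma swap_rcons2 phi s y z : swap (size s) phi (rcons (rcons s y) z) =
  (z%:R - y%:R)^-1 * phi (rcons (rcons s y) z) +
  (1 - (z%:R - y%:R)^-1) * phi (rcons (rcons s z) y).
Proof. by rewrite -!cats1 -!catA /= swap_cat. Qed.

(** Exchanging y and z in half of the double sum reduces operator relations to identities between
    coefficients. *)
Lemma sum_swap_rcons2 (F G : nat -> nat -> K) phi s N :
  (forall y z, F y z / (z%:R - y%:R) + F z y * (1 - (y%:R - z%:R)^-1) = G y z) ->
  \sum_(y < N) \sum_(z < N) F y z * swap (size s) phi (rcons (rcons s y) z)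
  = \sum_(y < N) \sum_(z < N) G y z * phi (rcons (rcons s y) z).
Proof.
move=> FG; under eq_bigr do under eq_bigr do rewrite swap_rcons2 mulrDr.
under eq_bigr do rewrite big_split /=.
rewrite big_split /= [X in _ + X]exchange_big -big_split; apply: eq_bigr => y _ /=.
rewrite -big_split; apply: eq_bigr => z _ /=; rewrite -FG; ring.
Qed.

Lemma mark_mark_swap phi s : good s ->
  mark (mark (swap (size s) phi)) s = mark (mark phi) s.
Proof.
move=> gs; have [N r] := room_exists 2 s.
rewrite !(mark_mark_room _ gs r); pose F y z := A y s * A z (y :: s).
apply: (@sum_swap_rcons2 F F) => y z; rewrite /F.
have [by_|ny] := boolP ((y == 0%N) || (y \in s)); have [bz|nz] := boolP ((z == 0%N) || (z \in s)).
- by rewrite !(append_coef_bad gs) // !mul0r addr0.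
- rewrite (append_coef_bad gs by_) !mul0r add0r (@append_coef_bad y (z :: s)) ?mulr0 ?mul0r //.
    by rewrite good_consN.
  by rewrite inE orbCA by_ orbT.
- rewrite (append_coef_bad gs bz) !mul0r addr0 (@append_coef_bad z (y :: s)) ?mulr0 ?mul0r //.
    by rewrite good_consN.
  by rewrite inE orbCA bz orbT.
have gy : good (y :: s) by rewrite good_consN.
have gz : good (z :: s) by rewrite good_consN.
have [<-|nyz] := eqVneq y z; last exact: append_coef_braid.
by rewrite (append_coef_mem gy) ?mem_head // mulr0 !mul0r addr0.
Qed.

Lemma merge_coef_rcons c s y z : g c (rcons s y) z = g c (y :: s) z.
Proof.
by congr (_ - _); [apply: append_coef_rcons | apply: append_coef_perm];
  rewrite // perm_cons perm_rcons.
Qed.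

Lemma room_tail k N c s : room k N (c :: s) -> room k N s.
Proof. by case/andP=> kN /= /andP[_ h]; apply/andP. Qed.

Lemma merge_mark_swap phi c s : good (c :: s) ->
  merge (mark (swap (size s) phi)) (c :: s) = mark (merge phi) (c :: s).
Proof.
move=> gcs; have gs : good s by move: gcs; rewrite good_cons => /and3P[].
have [N r] := room_exists 2 (c :: s).
have mc psi : merge (mark psi) (c :: s) = q c * \sum_(y < N) \sum_(z < N)
    g c s y * A z ((y : nat) :: s) * psi (rcons (rcons s y) z).
  rewrite (merge_room _ gcs (room_le r)); congr (_ * _); apply: eq_bigr => y _.
  have [->|gy] := eqVneq (g c s y) 0.
    by rewrite mul0r big1 // => z _; rewrite !mul0r.
  have gsy : good (rcons s y).
    rewrite good_rcons gs andbT lt0n -negb_or; apply: contraNN gy => yb.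
    by rewrite merge_coef_eq0.
  rewrite (@mark_room _ _ N gsy); last first.
    have [Ay|Ay] := eqVneq (A y s) 0; last exact: room_rcons (room_tail r).
    apply: (@room_tail _ _ c); rewrite -rcons_cons; apply: room_rcons r.
    by apply: contraNneq gy; rewrite /g Ay => ->; rewrite subrr.
  by rewrite mulr_sumr; apply: eq_bigr => z _; rewrite append_coef_rcons mulrA.
have cm : mark (merge phi) (c :: s) = q c * \sum_(y < N) \sum_(z < N)
    A y (c :: s) * g c ((y : nat) :: s) z * phi (rcons (rcons s y) z).
  rewrite (mark_room _ gcs (room_le r)) mulr_sumr; apply: eq_bigr => y _.
  have [->|Ay] := eqVneq (A y (c :: s)) 0.
    by rewrite mul0r big1 ?mulr0 // => z _; rewrite !mul0r.
  have gcsy : good (rcons (c :: s) y).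
    rewrite good_rcons gcs andbT lt0n -negb_or; apply: contraNN Ay => yb.
    by rewrite append_coef_bad.
  rewrite rcons_cons (merge_room _ gcsy (room_rcons Ay r)) mulrCA; congr (_ * _).
  by rewrite mulr_sumr; apply: eq_bigr => z _; rewrite merge_coef_rcons mulrA.
rewrite mc cm; congr (_ * _).
pose F y z := g c s y * A z (y :: s).
pose G y z := A y (c :: s) * g c (y :: s) z.
apply: (@sum_swap_rcons2 F G) => y z; rewrite /F /G.
have bad_cons x (t : nat) : (x == 0%N) || (x \in s) -> good (t :: s) -> A x (t :: s) = 0.
  by move=> bx gt; rewrite append_coef_bad // inE orbCA bx orbT.
have [by_|ny] := boolP ((y == 0%N) || (y \in s)); have [bz|nz] := boolP ((z == 0%N) || (z \in s)).
- by rewrite !(merge_coef_eq0 gcs) // (bad_cons y c) // !mul0r addr0.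
- rewrite (merge_coef_eq0 gcs by_) !mul0r add0r (bad_cons y c) // (bad_cons y z) //.
    by rewrite mulr0 !mul0r.
  by rewrite good_consN.
- rewrite (merge_coef_eq0 gcs bz) !mul0r addr0 (bad_cons z y) ?good_consN //.
  have [yc|nyc] := eqVneq y c.
    by subst y; rewrite (append_coef_mem (y := c) gcs) ?mem_head // mulr0 !mul0r.
  rewrite (@merge_coef_eq0 c (y :: s)) ?mulr0 ?mul0r //; last first.
    by rewrite inE orbCA bz orbT.
  by apply: good_cons2; rewrite // good_consN.
have gy : good (y :: s) by rewrite good_consN.
have gz : good (z :: s) by rewrite good_consN.
have [<-|nyz] := eqVneq y z; last exact: merge_coef_braid.
rewrite (append_coef_mem gy) ?mem_head // !mulr0 !mul0r add0r.
have [->|nyc] := eqVneq y c; first by rewrite (append_coef_mem (y := c) gcs) ?mem_head ?mul0r.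
rewrite merge_coef_eq0 ?mulr0 ?mem_head ?orbT //.
by rewrite good_cons2.
Qed.

Lemma merge_unmark phi c d s : good [:: c, d & s] ->
  merge (unmark phi) [:: c, d & s] = swap 0 (unmark (merge phi)) [:: c, d & s].
Proof.
move=> gcds; have gdcs : good [:: d, c & s].
  by rewrite -(good_perm (s := [:: c, d & s])) //; apply/permPl/(perm_catCA [:: c] [:: d] s).
have gds : good (d :: s) by move: gcds; rewrite good_cons => /and3P[].
have gcs : good (c :: s) by move: gdcs; rewrite good_cons => /and3P[].
have [N r] := room_exists 1 [:: c, d & s].
have rd := room_tail r.
have rc : room 1 N (c :: s).
  by move: r; rewrite /room /= => /and4P[-> -> _ ->].
rewrite (merge_room _ gcds r) (swap_cat [::] c d s) /=.
rewrite (merge_room _ gds rd) (merge_room _ gcs rc) !mulr_sumr -big_split.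
apply: eq_bigr => y _ /=; rewrite merge_coef_swap //; ring.
Qed.

(** Formal consequence of the two preceding relations, after expanding one factor C as MD - DM. *)
Lemma merge_merge_swap phi c d s : good [:: c, d & s] ->
  merge (merge (swap (size s) phi)) [:: c, d & s]
  = swap 0 (merge (merge phi)) [:: c, d & s].
Proof.
move=> gcds; have gdcs : good [:: d, c & s].
  by rewrite -(good_perm (s := [:: c, d & s])) //; apply/permPl/(perm_catCA [:: c] [:: d] s).
have gds : good (d :: s) by move: gcds; rewrite good_cons => /and3P[].
have gcs : good (c :: s) by move: gdcs; rewrite good_cons => /and3P[].
rewrite [LHS]mergeB [RHS]swapB; congr (_ - _).
  rewrite merge_unmark // !(swap_cat [::]) /= !merge_mark_swap //.
rewrite -mark_swap //.
have -> : merge (mark (unmark (swap (size s) phi))) [:: c, d & s]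
    = merge (mark (swap (size (d :: s)) (unmark phi))) [:: c, d & s].
  apply: eq_merge => // y y0 ys; apply: eq_mark => // [|z _ _].
    by rewrite good_rcons y0 ys.
  by rewrite !rcons_cons unmark_swap.
rewrite merge_mark_swap //; apply: eq_mark => // y y0 ys.
rewrite !rcons_cons merge_unmark // -!rcons_cons.
by rewrite good_rcons y0 ys.
Qed.

(** * The vectors attached to monomials *)

(** C drops the oldest entry, hence the shift of the position by one. *)
Lemma merge_swap i phi c s : good (c :: s) -> (i.+1 < size s)%N ->
  merge (swap i phi) (c :: s) = swap i.+1 (merge phi) (c :: s).
Proof.
move=> gcs lt_i; have gs : good s by move: gcs; rewrite good_cons => /and3P[].
rewrite [RHS]swapB; congr (_ - _).
  by rewrite -unmark_swap /= mark_swap.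
by rewrite -mark_swap //; apply: eq_mark => // y _ _; rewrite rcons_cons unmark_swap.
Qed.

(* [monomial r phi] is the value of phi at the vector T_a, where r lists the  *)
(* a_i - 1 from the newest marked vertex to the oldest.                       *)
Fixpoint monomial_rec n (r : seq nat) phi : K :=
  if n is n'.+1 then
    match r with
    | [::] => phi [::]
    | 0 :: r' => monomial_rec n' r' (mark phi)
    | b.+1 :: r' => monomial_rec n' (rcons r' b) (merge phi)
    end
  else phi [::].

(** Each rule lowers [size r + sumn r] by one, so this fuel suffices to reach the empty list. *)
Definition monomial r := monomial_rec (size r + sumn r) r.

Lemma monomial_nil phi : monomial [::] phi = phi [::].
Proof. by []. Qed.

Lemma monomial0 r phi : monomial (0%N :: r) phi = monomial r (mark phi).
Proof. by []. Qed.

Lemma monomialS b r phi : monomial (b.+1 :: r) phi = monomial (rcons r b) (merge phi).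
Proof.
rewrite /monomial /= size_rcons sumn_rcons.
by have -> : (size r + (b.+1 + sumn r) = (size r).+1 + (sumn r + b))%N by lia.
Qed.

Lemma monomial_ind (P : seq nat -> Prop) :
  P [::] -> (forall r, P r -> P (0%N :: r)) ->
  (forall b r, P (rcons r b) -> P (b.+1 :: r)) -> forall r, P r.
Proof.
move=> P0 Pm Pc r; have [n] := ubnP (size r + sumn r).
elim: n r => // n IHn [|[|b] r] //= lt_n; first exact/Pm/IHn.
by apply/Pc/IHn; move: lt_n; rewrite size_rcons sumn_rcons; lia.
Qed.

Lemma eq_monomial r phi psi :
  (forall s, size s = size r -> good s -> phi s = psi s) ->
  monomial r phi = monomial r psi.
Proof.
elim/monomial_ind: r phi psi => [|r IHr|b r IHr] phi psi e.
- exact: e.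
- rewrite !monomial0; apply: IHr => s ss gs; apply: eq_mark => // y y0 ys.
  by apply: e; rewrite ?size_rcons ?ss ?good_rcons ?y0 ?ys.
rewrite !monomialS; apply: IHr => -[|c s]; rewrite size_rcons // => -[ss] gcs.
apply: eq_merge => // y y0 ys; apply: e; rewrite ?size_rcons ?ss //.
by rewrite good_rcons y0 ys; move: gcs; rewrite good_cons => /and3P[].
Qed.

Lemma monomialB r phi psi :
  monomial r (fun s => phi s - psi s) = monomial r phi - monomial r psi.
Proof.
elim/monomial_ind: r phi psi => [|r IHr|b r IHr] phi psi //.
- by rewrite !monomial0 -IHr; apply: eq_monomial => s _ _; apply: markB.
by rewrite !monomialS -IHr; apply: eq_monomial => s _ _; apply: mergeB.
Qed.

(** Away from the newest end, S commutes with the rule that builds T_a. At that end, the relations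
    for MM, MC and CC cover the cases where each exponent is 1 or larger. *)
Lemma monomial_swap r1 x y r2 phi :
  monomial (r1 ++ [:: x, y & r2]) (swap (size r2) phi)
  = monomial (r1 ++ [:: y, x & r2]) phi.
Proof.
have [n] := ubnP (size (r1 ++ [:: x, y & r2]) + sumn (r1 ++ [:: x, y & r2])).
elim: n r1 x y r2 phi => // n IHn [|[|b] r1] x y r2 phi; last first.
- move=> lt_n; rewrite !cat_cons !monomialS !rcons_cat !rcons_cons -[RHS]IHn; last first.
    by move: lt_n; rewrite /= !size_cat !sumn_cat /= !size_rcons !sumn_rcons; lia.
  apply: eq_monomial => -[|c s]; rewrite size_cat /= size_rcons ?addnS // => -[ss] gcs.
  by rewrite merge_swap // ss !ltnS leq_addl.
- move=> lt_n; rewrite !cat_cons !monomial0 -[RHS]IHn //.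
  by apply: eq_monomial => s ss gs; rewrite mark_swap // ss size_cat /= !addnS !ltnS leq_addl.
rewrite !cat0s; case: x y => [|x] [|y] lt_n.
- by rewrite !monomial0; apply: eq_monomial => s ss gs; rewrite -ss mark_mark_swap.
- rewrite monomial0 !monomialS monomial0.
  apply: eq_monomial => -[|c s]; rewrite size_rcons // => -[ss] gcs.
  by rewrite -ss merge_mark_swap.
- rewrite monomial0 !monomialS monomial0.
  apply: eq_monomial => -[|c s]; rewrite size_rcons // => -[ss] gcs.
  rewrite -ss -merge_mark_swap //; apply: eq_merge => // z z0 zs.
  have gs : good s by move: gcs; rewrite good_cons => /and3P[].
  have gsz : good (rcons s z) by rewrite good_rcons z0 zs.
  apply: eq_mark => // w w0 ws; rewrite swapK ?size_rcons //.
  by rewrite good_rcons w0 ws.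
(* Two applications of C carry the pair to the oldest end with both exponents lowered, where the
   induction hypothesis applies. *)
rewrite !monomialS.
have -> a b : rcons (rcons r2 a) b = r2 ++ [:: a; b] by rewrite -!cats1 -catA.
have -> a b : rcons (rcons r2 a) b = r2 ++ [:: a; b] by rewrite -!cats1 -catA.
rewrite -[RHS]IHn; last by move: lt_n; rewrite /= !size_cat !sumn_cat /=; lia.
apply: eq_monomial => -[|c [|d s]]; rewrite size_cat /= ?addn2 // => -[ss] gcds.
by rewrite -ss merge_merge_swap.
Qed.

Fixpoint bumps k (r : seq nat) : seq (seq nat) :=
  if r is x :: r' then (x + k :: r')%N :: [seq x :: t | t <- bumps k r'] else [::].

Lemma bumps_rcons k r b :
  bumps k (rcons r b) = rcons [seq rcons t b | t <- bumps k r] (rcons r (b + k)%N).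
Proof.
elim: r => [|x r IHr] //=; rewrite IHr map_rcons -!map_comp; congr (_ :: rcons _ _).
Qed.

Variables e p : nat -> K.
Hypothesis e_neq0 : forall i, e i != 0.
Hypothesis qE : forall i, q i.+1 = e i.+1 / e i.
Hypothesis e0 : e 0%N = 1.
Hypothesis newton : forall i, newton_sum e p i = i.+1%:R * e i.+1.

Lemma mark_nil phi : mark phi [::] = phi [:: 1%N].
Proof. by rewrite /mark big_nil big_nat1 /A /= big_nil mul1r. Qed.

Lemma mark_seq1 phi i : mark phi [:: i.+1] =
  (i%:R * phi [:: i.+1; 1%N] + i.+2%:R * phi [:: i.+1; i.+2]) / i.+1%:R.
Proof.
rewrite /mark big_seq1 big_nat_recl // big_nat_recr //= big_nat_cond big1 ?add0r; last first.
  move=> y /andP[/andP[y1 lt_y] _]; rewrite append_coef_eq0 ?mul0r // ?eqSS -?lt0n //=.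
  by rewrite inE neq_ltn lt_y.
rewrite /A /= mem_head big_seq1 big_cons eqxx big_nil mulr1 -[i.+1%:R]natr1 addrK.
by rewrite -[i.+2%:R]natr1 -[i.+1%:R]natr1 /=; field; rewrite natr1 natK_neq0.
Qed.

Lemma merge_seq1 phi i : merge phi [:: i.+1] =
  q i.+1 / i.+1%:R * (phi [:: 1%N] - i.+2%:R * phi [:: i.+2]).
Proof.
rewrite /merge /= mark_nil mark_seq1 /=.
by rewrite -[i.+2%:R]natr1 -[i.+1%:R]natr1; field; rewrite natr1 natK_neq0.
Qed.

(** Expresses (i + 1) e_i b_(i+1) through the vectors T_(j+1); the induction steps from b_(i+1) to
    b_(i+2) by [merge_seq1]. *)
Lemma monomial_expand phi i : i.+1%:R * e i * phi [:: i.+1]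
  = \sum_(j < i.+1) (-1) ^+ j * e (i - j) * monomial [:: val j] phi.
Proof.
elim: i phi => [|i IHi] phi.
  by rewrite big_ord1 monomial0 monomial_nil mark_nil expr0 subnn.
rewrite big_ord_recl expr0 subn0 monomial0 monomial_nil mark_nil.
under eq_bigr do rewrite /= monomialS exprS subSS -!mulrA mulN1r mulrA.
rewrite sumrN -IHi merge_seq1 qE; have := natK_neq0 i; have := e_neq0 i => ei0 i0; field.
by rewrite nat1r i0 ei0.
Qed.

(** Since D b_(i+1) = (e_(i+1) / e_i) b_(), [monomial_expand] says that the D T_(j+1) solve Newton's
    system, whose solution is unique. *)
Lemma monomial_unmark1 phi j : monomial [:: j] (unmark phi) = p j * phi [::].
Proof.
move: j; apply: (newton_sum_inj (v := fun j => p j * phi [::]) e0) => i.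
rewrite /newton_sum -monomial_expand /= qE; under eq_bigr do rewrite mulrA.
rewrite -mulr_suml -/(newton_sum e p i) newton.
by have := e_neq0 i => ei0; field; rewrite ei0.
Qed.

Lemma monomial_unmark r a phi : monomial (rcons r a) (unmark phi)
  = p a * monomial r phi - \sum_(t <- bumps a.+1 r) monomial t phi.
Proof.
elim/monomial_ind: r phi => [|r IHr|b r IHr] phi.
- by rewrite big_nil subr0 monomial_unmark1.
- rewrite rcons_cons monomial0 /= big_cons big_map.
  (* DM = MD - C, and the C term is the bump of the newest exponent. *)
  have -> : monomial (rcons r a) (mark (unmark phi)) =
      monomial (rcons r a) (unmark (mark phi)) - monomial (rcons r a) (merge phi).
    rewrite -monomialB; apply: eq_monomial => s _ _.
    by rewrite /merge subKr.
  rewrite IHr add0n monomialS monomial0 -addrA -opprD.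
  by rewrite [_ + monomial (rcons _ _) _]addrC.
rewrite rcons_cons !monomialS /= big_cons big_map.
have -> : rcons (rcons r a) b = r ++ [:: a; b] by rewrite -!cats1 -catA.
(* D C = C D S lets D act before C; the transposition then puts [a] back at the oldest place. *)
transitivity (monomial (r ++ [:: a; b]) (swap 0 (unmark (merge phi)))).
  apply: eq_monomial => -[|c [|d s]]; rewrite size_cat /= ?addn2 // => _ gcds.
  exact: merge_unmark.
rewrite (monomial_swap r a b [::]).
have -> : r ++ [:: b; a] = rcons (rcons r b) a by rewrite -!cats1 -catA.
rewrite IHr bumps_rcons big_rcons /= big_map addSn monomialS addnS.
under [in RHS]eq_bigr do rewrite monomialS.
by rewrite [X in _ - X = _]addrC.
Qed.

End Coefficients.

(** * Building a graph one vertex at a time *)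

(** Polymorphic in the state so that colour sums, formal terms, functionals on V_k and a trivial
    state share the same run; the first component counts marked vertices. *)
Definition add_vertex X (f u : X -> X) (st : nat * X) (r : nat) :=
  let j := (st.1 - r)%N in ((st.1 - j).+1, f (iter j u st.2)).

Definition process X (f u : X -> X) (x0 : X) (ds : seq nat) :=
  foldl (add_vertex f u) (0%N, x0) ds.

Definition outcome X (f u : X -> X) (x0 : X) (ds : seq nat) : X :=
  let st := process f u x0 ds in iter st.1 u st.2.

Section ProcessRel.
Variables (X Y : Type) (mX uX : X -> X) (mY uY : Y -> Y).
Variable R : nat -> X -> Y -> Prop.
Hypothesis R_unmark : forall s x y, R s.+1 x y -> R s (uX x) (uY y).
Hypothesis R_mark : forall s x y, R s x y -> R s.+1 (mX x) (mY y).

Lemma R_iter_unmark j s x y : (j <= s)%N -> R s x y ->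
  R (s - j) (iter j uX x) (iter j uY y).
Proof.
elim: j s x y => [|j IHj] [|s] x y //.
by rewrite ltnS => le_js Rxy; rewrite !iterSr subSS; apply: IHj => //; apply: R_unmark.
Qed.

Lemma process_rel x0 y0 ds : R 0 x0 y0 ->
  let px := process mX uX x0 ds in let py := process mY uY y0 ds in
  px.1 = py.1 /\ R px.1 px.2 py.2.
Proof.
move=> R0; elim/last_ind: ds => [|ds r IH] //=.
rewrite /process !foldl_rcons -!/(process _ _ _ _).
case: (process _ _ x0 _) (process _ _ y0 _) IH => [s x] [_ y] /= [<- Rxy].
by split=> //; apply/R_mark/R_iter_unmark; rewrite // leq_subr.
Qed.

Lemma outcome_rel x0 y0 ds : R 0 x0 y0 ->
  R 0 (outcome mX uX x0 ds) (outcome mY uY y0 ds).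
Proof.
move=> /(process_rel ds) [e Rxy]; rewrite /outcome -e -(subnn (process mX uX x0 ds).1).
exact: R_iter_unmark.
Qed.

End ProcessRel.

(** * Formal combinations of monomials in the marked colours *)

Section Terms.
Variables (P : comNzRingType) (p : nat -> P).

Definition mark_terms (l : seq (P * seq nat)) := [seq (t.1, 0%N :: t.2) | t <- l].

Definition unmark_term (t : P * seq nat) :=
  let a := last 0%N t.2 in let r := take (size t.2).-1 t.2 in
  (t.1 * p a, r) :: [seq (- t.1, r') | r' <- bumps a.+1 r].

Definition unmark_terms l := flatten [seq unmark_term t | t <- l].

Lemma unmark_term_rcons c r a : unmark_term (c, rcons r a) =
  (c * p a, r) :: [seq (- c, r') | r' <- bumps a.+1 r].
Proof. by rewrite /unmark_term /= last_rcons size_rcons -cats1 take_size_cat. Qed.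

Lemma size_bumps k r t : t \in bumps k r -> size t = size r.
Proof.
elim: r t => [|x r IHr] t //=; rewrite inE => /orP[/eqP-> //|/mapP[t' /IHr e ->]].
by rewrite /= e.
Qed.

Definition terms_of_size s (l : seq (P * seq nat)) := forall t, t \in l -> size t.2 = s.

Lemma mark_terms_size s l : terms_of_size s l -> terms_of_size s.+1 (mark_terms l).
Proof. by move=> sl t /mapP[u /sl <- ->]. Qed.

Lemma unmark_terms_size s l : terms_of_size s.+1 l -> terms_of_size s (unmark_terms l).
Proof.
move=> sl t /flatten_mapP[[c r] /sl /=]; case/lastP: r => [|r a] //.
rewrite size_rcons => -[<-]; rewrite unmark_term_rcons inE => /orP[/eqP-> //|].
by case/mapP=> r' /size_bumps e ->.
Qed.

Lemma sum_unmark_terms (V : zmodType) (F : P -> seq nat -> V) (G : P -> seq nat -> V) s l :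
  terms_of_size s.+1 l ->
  (forall c r a, size r = s -> G c (rcons r a) =
     F (c * p a) r + \sum_(t <- bumps a.+1 r) F (- c) t) ->
  \sum_(t <- l) G t.1 t.2 = \sum_(t <- unmark_terms l) F t.1 t.2.
Proof.
move=> sl FG; rewrite big_flatten big_map /= big_seq [RHS]big_seq.
apply: eq_bigr => -[c r] /sl /=; case/lastP: r => [|r a] //; rewrite size_rcons => -[sr].
by rewrite unmark_term_rcons big_cons big_map /= FG.
Qed.

Definition constant_terms (l : seq (P * seq nat)) := \sum_(t <- l) t.1.

End Terms.

(** * Sums over proper colourings *)

Section Colorings.
Variables (P R : comNzRingType) (p : nat -> P) (ev : {rmorphism P -> R}).
Variables (S : seq nat) (x : nat -> R).
Hypothesis S_uniq : uniq S.
Hypothesis ev_p : forall a, ev (p a) = \sum_(z <- S) x z ^+ a.+1.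
Implicit Types (c r : seq nat) (G : seq nat -> R) (l : seq (P * seq nat)).

(* Here c lists the colours of the marked vertices from the newest to the     *)
(* oldest.                                                                    *)
Definition mark_color G c : R := if c is z :: c' then G c' * x z else 0.
Definition unmark_color G c : R := \sum_(z <- S | z \notin c) G (rcons c z).

Fixpoint color_monomial r c : R :=
  match r, c with
  | a :: r', z :: c' => x z ^+ a.+1 * color_monomial r' c'
  | _, _ => 1
  end.

Definition color_eval l c := \sum_(t <- l) ev t.1 * color_monomial t.2 c.

Lemma color_monomial_rcons r a c z : size r = size c ->
  color_monomial (rcons r a) (rcons c z) = color_monomial r c * x z ^+ a.+1.
Proof.
elim: r c => [|b r IHr] [|y c] //=; first by rewrite mulr1 mul1r.
by move=> [e]; rewrite IHr // mulrA.
Qed.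

Lemma sum_bumps k r c : size r = size c ->
  \sum_(t <- bumps k r) color_monomial t c
  = (\sum_(z <- c) x z ^+ k) * color_monomial r c.
Proof.
elim: r c => [|b r IHr] [|y c] //= => [_|[e]]; first by rewrite !big_nil mul0r.
rewrite !big_cons big_map /= -mulr_sumr IHr // -addSn exprD; ring.
Qed.

Definition color_agree s l G := terms_of_size s l /\
  forall c, size c = s -> uniq c -> {subset c <= S} -> G c = color_eval l c.

Lemma color_agree_mark s l G : color_agree s l G ->
  color_agree s.+1 (mark_terms l) (mark_color G).
Proof.
case=> sl e; split; first exact: mark_terms_size.
case=> [|z c] //= [sc] /andP[_ uc] cS; rewrite e //; last first.
  by move=> y yc; rewrite cS // inE yc orbT.
by rewrite /color_eval big_map mulr_suml; apply: eq_bigr => t _ /=; rewrite -mulrA [x z * _]mulrC.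
Qed.

(** The sum over z outside c is the sum over S, a power sum by [ev_p], minus the sum over c, which
    [sum_bumps] identifies with the bumped monomials. *)
Lemma color_agree_unmark s l G : color_agree s.+1 l G ->
  color_agree s (unmark_terms p l) (unmark_color G).
Proof.
case=> sl e; split; first exact: unmark_terms_size.
move=> c sc uc cS; rewrite /unmark_color /color_eval.
pose H a r := \sum_(z <- S | z \notin c) ev a * color_monomial r (rcons c z).
rewrite -(@sum_unmark_terms _ p _ (fun a r => ev a * color_monomial r c) H s) //.
  rewrite /H exchange_big /= big_seq_cond [RHS]big_seq_cond; apply: eq_bigr => z /andP[zS zc].
  rewrite e ?size_rcons ?sc ?rcons_uniq ?zc // => y.
  by rewrite mem_rcons inE => /orP[/eqP->|/cS].
move=> a r b sr; rewrite /H -mulr_sumr.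
under eq_bigr do rewrite color_monomial_rcons ?sr ?sc //.
rewrite -mulr_sumr rmorphM ev_p rmorphN -mulr_sumr sum_bumps ?sr ?sc //.
have -> : \sum_(z <- c) x z ^+ b.+1 = \sum_(z <- S | z \in c) x z ^+ b.+1.
  rewrite -[RHS]big_filter; apply: perm_big; apply: uniq_perm; rewrite ?filter_uniq //.
  by move=> z; rewrite mem_filter; symmetry; apply: andb_idr => /cS.
rewrite [\sum_(z <- S) _](bigID (mem c)) /=; ring.
Qed.

Lemma color_outcome ds :
  outcome mark_color unmark_color (fun=> 1) ds [::] =
  ev (constant_terms (outcome (@mark_terms P) (unmark_terms p) [:: (1, [::])] ds)).
Proof.
have [] := @outcome_rel _ _ (@mark_terms P) (unmark_terms p) mark_color unmark_color color_agree
  color_agree_unmark color_agree_mark [:: (1, [::])] (fun=> 1) ds.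
  split=> [t|c sc _ _]; first by rewrite inE => /eqP->.
  by rewrite /color_eval big_seq1 /= rmorph1 mul1r.
move=> sl -> //; rewrite /color_eval rmorph_sum /= big_seq [RHS]big_seq.
by apply: eq_bigr => t /sl; case: (t.2) => // _; rewrite mulr1.
Qed.

End Colorings.

(* Both lists start from the last vertex: rds gives the numbers of smaller    *)
(* neighbours, kappa the colours.                                             *)
Fixpoint proper_word (rds kappa : seq nat) : bool :=
  match rds, kappa with
  | r :: rds', z :: kappa' => (z \notin take r kappa') && proper_word rds' kappa'
  | [::], [::] => true
  | _, _ => false
  end.

Definition marked_count (rds : seq nat) := if rds is r :: _ then r.+1 else 0%N.

Fixpoint valid_degrees (rds : seq nat) : bool :=
  if rds is r :: rds' then (r <= marked_count rds')%N && valid_degrees rds' else true.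

Lemma marked_count_size rds : valid_degrees rds -> (marked_count rds <= size rds)%N.
Proof.
elim: rds => // r rds IH /= /andP[le_r /IH]; exact: leq_trans.
Qed.

(** The marked vertices form a clique: a new vertex is adjacent to the r kept ones, which were
    already pairwise adjacent. *)
Lemma proper_word_uniq rds kappa : valid_degrees rds -> proper_word rds kappa ->
  uniq (take (marked_count rds) kappa).
Proof.
elim: rds kappa => [|r rds IH] [|z kappa] //= /andP[le_r vr] /andP[-> pk] /=.
by rewrite -(take_takel _ le_r); apply: take_uniq (IH _ vr pk).
Qed.

Section Words.
Variables (R : comNzRingType) (S : seq nat) (x : nat -> R).
Implicit Types (F : seq nat -> R) (c rds ds : seq nat).

Fixpoint sum_words k F : R :=
  if k is k'.+1 then \sum_(z <- S) sum_words k' (fun kappa => F (z :: kappa))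
  else F [::].

Lemma eq_sum_words k F G : F =1 G -> sum_words k F = sum_words k G.
Proof.
by elim: k F G => [|k IHk] F G FG //=; apply: eq_bigr => z _; apply: IHk => w.
Qed.

Lemma sum_words0 k : sum_words k (fun=> 0) = 0.
Proof. by elim: k => //= k ->; rewrite big1. Qed.

Lemma sum_wordsZ k a F : sum_words k (fun kappa => F kappa * a) = sum_words k F * a.
Proof.
by elim: k F => [|k IHk] F //=; rewrite mulr_suml; apply: eq_bigr => z _; apply: IHk.
Qed.

Definition word_weight rds kappa : R :=
  if proper_word rds kappa then \prod_(z <- kappa) x z else 0.

(** The state once only the s newest vertices remain marked, with colours c: all older colours have
    been summed out. *)
Definition tail_sum rds s c :=
  sum_words (size rds - s) (fun kappa => word_weight rds (c ++ kappa)).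

(** [tail_sum] lets the next colour z range over all of S, but words with z in c are improper and
    weigh 0. *)
Lemma unmark_tail_sum rds s c : valid_degrees rds -> (s < marked_count rds)%N ->
  size c = s -> unmark_color S (tail_sum rds s.+1) c = tail_sum rds s c.
Proof.
move=> vr lt_s sc; have lt_rds := leq_trans lt_s (marked_count_size vr).
rewrite /tail_sum /unmark_color -(subnSK lt_rds) /= big_mkcond /=.
apply: eq_bigr => z _; under eq_sum_words do rewrite cat_rcons.
case: ifPn => // /negbNE zc; rewrite -[LHS](sum_words0 (size rds - s.+1)).
apply: eq_sum_words => w; rewrite /word_weight; case: ifP => // pw.
have := proper_word_uniq vr pw; rewrite -cat_rcons => u.
have : uniq (take s.+1 (take (marked_count rds) (rcons c z ++ w))) by apply: take_uniq.
by rewrite take_takel // take_size_cat ?size_rcons ?sc // rcons_uniq zc.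
Qed.

Lemma mark_tail_sum rds s c : uniq c -> size c = s.+1 ->
  mark_color x (tail_sum rds s) c = tail_sum (s :: rds) s.+1 c.
Proof.
case: c => // z c /= /andP[zc _] [sc]; rewrite /tail_sum subSS -sum_wordsZ.
apply: eq_sum_words => w; rewrite /word_weight /= take_size_cat // zc /=.
by case: ifP; rewrite ?mul0r // big_cons mulrC.
Qed.

Lemma iter_unmark_tail_sum rds G j c : valid_degrees rds ->
  (forall c, uniq c -> size c = marked_count rds ->
    G c = tail_sum rds (marked_count rds) c) ->
  (j <= marked_count rds)%N -> uniq c -> size c = (marked_count rds - j)%N ->
  iter j (unmark_color S) G c = tail_sum rds (marked_count rds - j) c.
Proof.
move=> vr eG; elim: j c => [|j IHj] c le_j uc sc; first by rewrite subn0 /= eG ?sc ?subn0.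
rewrite iterS -unmark_tail_sum //; last by lia.
apply: eq_bigr => z zc; rewrite subnSK // IHj ?rcons_uniq ?zc //; first exact: ltnW.
by rewrite size_rcons sc subnSK.
Qed.

Lemma process_tail_sum ds : valid_degrees (rev ds) ->
  let st := process (mark_color x) (unmark_color S) (fun=> 1) ds in
  st.1 = marked_count (rev ds) /\
  forall c, uniq c -> size c = st.1 -> st.2 c = tail_sum (rev ds) st.1 c.
Proof.
elim/last_ind: ds => [_|ds r IH] /=.
  split=> // -[|] // _ _; by rewrite /tail_sum /= /word_weight big_nil.
rewrite rev_rcons /= => /andP[le_r vr]; move: (IH vr); rewrite /process foldl_rcons.
case: foldl => s G /= [es eG]; subst s; rewrite /add_vertex /= subKn //; split=> // c uc sc.
rewrite -mark_tail_sum //; case: c uc sc => // z c /= /andP[_ uc] [sc]; congr (_ * _).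
by have := iter_unmark_tail_sum vr eG (leq_subr r _) uc; rewrite subKn // => ->.
Qed.

Lemma color_outcome_words ds : valid_degrees (rev ds) ->
  outcome (mark_color x) (unmark_color S) (fun=> 1) ds [::] =
  sum_words (size ds) (word_weight (rev ds)).
Proof.
move=> vr; have [es eG] := process_tail_sum vr; rewrite /outcome es.
rewrite es in eG; have := iter_unmark_tail_sum (c := [::]) vr eG (leqnn _) isT.
by rewrite subnn => ->; rewrite // /tail_sum subn0 size_rev.
Qed.

End Words.

Lemma sum_words_tuple (R : comNzRingType) (T : finType) (f : T -> nat) k
    (F : seq nat -> R) :
  sum_words [seq f t | t <- enum T] k F = \sum_(t : k.-tuple T) F (map f t).
Proof.
elim: k F => [|k IHk] F /=.
  by rewrite (bigD1 [tuple]) //= big1 ?addr0 // => t /eqP[]; exact: tuple0.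
rewrite big_map big_enum /=; under eq_bigr do rewrite IHk.
rewrite pair_big /= (reindex (fun zt : T * k.-tuple T => [tuple of zt.1 :: zt.2])) //=.
exists (fun t => (thead t, [tuple of behead t])) => [[z t]|t] _ /=.
  by congr (_, _); apply: val_inj.
by rewrite [RHS]tuple_eta; apply: val_inj.
Qed.

Lemma sum_words_ffun (R : comNzRingType) (T : finType) (f : T -> nat) n
    (F : seq nat -> R) :
  sum_words [seq f t | t <- enum T] n F =
  \sum_(kappa : {ffun 'I_n -> T}) F (rev [seq f (kappa v) | v <- enum 'I_n]).
Proof.
rewrite sum_words_tuple.
pose h (kappa : {ffun 'I_n -> T}) := [tuple kappa (rev_ord i) | i < n].
rewrite (reindex h) /=; last first.
  exists (fun t : n.-tuple T => [ffun i => tnth t (rev_ord i)]) => [kappa|t] _.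
    by apply/ffunP => i; rewrite ffunE tnth_mktuple rev_ordK.
  by apply: eq_from_tnth => i; rewrite tnth_mktuple ffunE rev_ordK.
apply: eq_bigr => kappa _; congr F; rewrite -map_comp.
apply: (@eq_from_nth _ 0%N).
  by rewrite size_rev !size_map.
move=> i; rewrite size_map size_enum_ord => lt_i; case: n h kappa lt_i => // n' h kappa lt_i.
have lt_i' : (n'.+1 - i.+1 < n'.+1)%N by rewrite subSS ltnS leq_subr.
rewrite nth_rev size_map size_enum_ord //.
rewrite !(nth_map ord0) -?enumT ?size_enum_ord //.
have -> : nth ord0 (enum 'I_n'.+1) i = Ordinal lt_i by apply/val_inj/nth_enum_ord.
have -> : nth ord0 (enum 'I_n'.+1) (n'.+1 - i.+1) = Ordinal lt_i'.
  exact/val_inj/nth_enum_ord.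
by congr (f (kappa _)); apply: val_inj.
Qed.

Lemma proper_word_mkseq (d kappa : nat -> nat) n :
  proper_word (rev (mkseq d n)) (rev (mkseq kappa n)) =
  all (fun v => all (fun u => kappa v != kappa u) (iota (v - d v) (v - (v - d v)))) (iota 0 n).
Proof.
elim: n => // n IHn; rewrite !mkseqS !rev_rcons [in LHS]/= IHn.
rewrite -[in RHS]addn1 iotaD all_cat /= add0n andbT andbC.
congr (_ && _); rewrite take_rev mem_rev size_mkseq /mkseq -map_drop drop_iota add0n.
apply/idP/allP => [H u ui|H].
  by apply: contraNneq H => ->; apply: map_f.
by apply/mapP => -[u /H + e]; rewrite e eqxx.
Qed.

(** * Natural unit interval graphs *)

Section IntervalGraph.
Variables (n : nat) (e : rel 'I_n).
Hypotheses (e_sym : symmetric e) (e_irr : irreflexive e) (e_nui : natural_unit_interval e).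
Local Notation degree := (smaller_degree e).

Lemma card_ord_interval a b : (b <= n)%N -> #|[set u : 'I_n | (a <= u < b)%N]| = (b - a)%N.
Proof.
move=> le_bn; rewrite cardsE cardE -(size_map val).
have -> : [seq val u | u <- enum [pred u : 'I_n | (a <= u < b)%N]] = iota a (b - a).
  apply: (irr_sorted_eq ltn_trans ltnn); last first.
  - move=> k; rewrite mem_iota; apply/mapP/andP => [[u]|[ak kb]].
      by rewrite mem_enum inE => /andP[au ub] -> /=; split=> //; lia.
    have kn : (k < n)%N by lia.
    by exists (Ordinal kn); rewrite // mem_enum inE /=; lia.
  - exact: iota_ltn_sorted.
  rewrite sorted_map; have := iota_ltn_sorted 0 n; rewrite -val_enum_ord sorted_map.
  have -> : enum [pred u : 'I_n | (a <= u < b)%N] = [seq u : 'I_n <- enum 'I_n | (a <= u < b)%N].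
    by rewrite [in RHS]enumT.
  by apply: sorted_filter => ? ? ?; apply: ltn_trans.
by rewrite size_iota.
Qed.

(** An edge u v makes all of u, ..., v - 1 neighbours of v; a non-edge confines the smaller
    neighbours to u + 1, ..., v - 1. Counting gives both directions. *)
Lemma smaller_degreeP (u v : 'I_n) : (u < v)%N -> e u v = (v - degree v <= u)%N.
Proof.
move=> lt_uv; have le_v : (v <= n)%N by apply/ltnW/ltn_ord.
apply/idP/idP => [euv|].
  rewrite leq_subCl -(card_ord_interval u le_v); apply/subset_leq_card/subsetP => w.
  rewrite !inE => /andP[le_uw lt_wv]; rewrite lt_wv /=.
  move: le_uw; rewrite leq_eqVlt => /orP[/eqP/val_inj <- //|lt_uw].
  by have [] := @e_nui u v w euv; rewrite ?lt_uw.
apply: contraTT => neuv; rewrite -ltnNge ltn_subRL addnC -ltn_subRL.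
have -> : (v - u = (v - u.+1).+1)%N by lia.
rewrite ltnS -(card_ord_interval u.+1 le_v); apply/subset_leq_card/subsetP => w.
rewrite !inE => /andP[lt_wv ewv]; rewrite lt_wv andbT ltnNge leq_eqVlt.
apply: contra neuv => /orP[/eqP/val_inj <- //|lt_wu].
by have [] := @e_nui w v u ewv; rewrite ?lt_wu.
Qed.

Lemma smaller_degree_le (v : 'I_n) : (degree v <= v)%N.
Proof.
rewrite -[X in (_ <= X)%N]subn0 -(@card_ord_interval 0 v) ?(ltnW (ltn_ord v)) //.
by apply/subset_leq_card/subsetP => w; rewrite !inE => /andP[-> _].
Qed.

(** A smaller neighbour of u + 1 other than u is a neighbour of u. *)
Lemma smaller_degreeS (u v : 'I_n) : v = u.+1 :> nat -> (degree v <= (degree u).+1)%N.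
Proof.
move=> vu; apply: leq_trans (_ : #|u |: [set w : 'I_n | (w < u)%N && e w u]| <= _)%N.
  apply/subset_leq_card/subsetP => w; rewrite !inE vu ltnS leq_eqVlt => /andP[+ ewv].
  case/orP=> [/eqP/val_inj ->|lt_wu]; first by rewrite eqxx.
  by have [] := @e_nui w v u ewv; rewrite ?lt_wu ?vu //= => -> _; rewrite orbT.
by rewrite cardsU1 -[(degree u).+1]add1n leq_add // leq_b1.
Qed.

Lemma map_enum_mkseq A (a0 : A) (h : 'I_n -> A) :
  [seq h v | v <- enum 'I_n] = mkseq (fun i => if insub i is Some v then h v else a0) n.
Proof.
rewrite /mkseq -val_enum_ord -map_comp; apply: eq_map => v /=.
by rewrite valK.
Qed.

Lemma valid_smaller_degrees : valid_degrees (rev [seq degree v | v <- enum 'I_n]).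
Proof.
rewrite (map_enum_mkseq 0%N); set d := fun i => _.
suff: forall k, (k <= n)%N -> valid_degrees (rev (mkseq d k)) by apply.
elim=> // k IHk lt_kn; rewrite mkseqS rev_rcons /= IHk ?andbT; last exact: ltnW.
case: k lt_kn {IHk} => [|k] lt_kn.
  by rewrite /d (insubT (fun i => i < n)%N lt_kn) /=; apply: smaller_degree_le.
rewrite mkseqS rev_rcons /= /d (insubT (fun i => i < n)%N lt_kn).
by rewrite (insubT (fun i => i < n)%N (ltnW lt_kn)); apply: smaller_degreeS.
Qed.

Lemma proper_word_smaller_degree (T : finType) (f : T -> nat) (kappa : {ffun 'I_n -> T}) :
  proper_word (rev [seq degree v | v <- enum 'I_n]) (rev [seq f (kappa v) | v <- enum 'I_n])
  = Defs.proper e (fun v => f (kappa v)).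
Proof.
rewrite !(map_enum_mkseq 0%N) proper_word_mkseq.
have fE (h : 'I_n -> nat) (v : 'I_n) : (if insub (val v) is Some w then h w else 0%N) = h v.
  by rewrite valK.
apply/allP/forallP => [H u|H i]; last first.
  rewrite mem_iota add0n /= => lt_in; apply/allP => j; rewrite mem_iota => /andP[le_j lt_j].
  have lt_jn : (j < n)%N by lia.
  move: le_j lt_j; rewrite (fE degree (Ordinal lt_in)).
  rewrite -[j]/(val (Ordinal lt_jn)) -[i]/(val (Ordinal lt_in)) !fE => le_j lt_j.
  have lt_ji : (Ordinal lt_jn < Ordinal lt_in)%N by move: lt_j => /=; lia.
  have := H (Ordinal lt_in) => /forallP /(_ (Ordinal lt_jn)); rewrite e_sym.
  by rewrite smaller_degreeP // le_j.
apply/forallP => v; apply/implyP => euv.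
wlog lt_uv : u v euv / (u < v)%N.
  move=> W; case: (ltngtP u v) => [|lt_vu|/val_inj uv]; first exact: W.
    by rewrite eq_sym; apply: W; rewrite // e_sym.
  by rewrite uv e_irr in euv.
have := H v; rewrite mem_iota /= ltn_ord => /(_ isT) /allP /(_ u).
rewrite mem_iota !fE eq_sym; apply; move: euv; rewrite smaller_degreeP // => -> /=.
by have := smaller_degree_le v; lia.
Qed.

Lemma chromatic_outcome (R : comNzRingType) (T : finType) (f : T -> nat) (x : nat -> R) :
  let ds := [seq degree v | v <- enum 'I_n] in
  outcome (mark_color x) (unmark_color [seq f t | t <- enum T]) (fun=> 1) ds [::] =
  \sum_(kappa : {ffun 'I_n -> T} | Defs.proper e (fun v => f (kappa v)))
    \prod_v x (f (kappa v)).
Proof.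
move=> ds; rewrite color_outcome_words; last exact: valid_smaller_degrees.
rewrite size_map size_enum_ord sum_words_ffun [RHS]big_mkcond; apply: eq_bigr => kappa _.
rewrite /word_weight proper_word_smaller_degree; case: ifP => // _.
by rewrite big_rev big_map big_enum.
Qed.

End IntervalGraph.

(** * Formal power series *)

Section Substitution.
Variables (R : comNzRingType) (h : nat -> R).
Implicit Types m : {cmonom nat}.

Definition monomial_subst m : R := \prod_(i <- finsupp m) h i ^+ m i.

Lemma monomial_subst_wide m (d : {fset nat}) : (finsupp m `<=` d)%fset ->
  monomial_subst m = \prod_(i <- d) h i ^+ m i.
Proof.
move=> le_d; rewrite /monomial_subst (big_fset_incl _ le_d) // => i _ im.
by move: im; rewrite -cmE_eq0 => /eqP->; rewrite expr0.
Qed.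

Lemma monomial_subst_is_multiplicative : mmorphism monomial_subst.
Proof.
split=> [m1 m2|]; last by rewrite /monomial_subst mdom1 big_seq_fset0.
set d := (finsupp m1 `|` finsupp m2)%fset.
rewrite !(@monomial_subst_wide _ d) ?fsubsetUl ?fsubsetUr ?mdomD //.
by rewrite -big_split /=; apply: eq_bigr => i _; rewrite cmM exprD.
Qed.

HB.instance Definition _ :=
  monalg.isMultiplicative.Build _ R monomial_subst monomial_subst_is_multiplicative.

Variable c : {rmorphism rat -> R}.

(** [esubst] is the instance [h i = elem i.+1]; other [h] allow finitely many variables. *)
Definition subst_e : {rmorphism epoly -> R} := mmap c monomial_subst.

End Substitution.

Definition e_gen (i : nat) : epoly := if i is j.+1 then << ucm j >> else 1.

Lemma subst_e_gen (R : comNzRingType) (h : nat -> R) c i :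
  subst_e h c (e_gen i.+1) = h i.
Proof.
rewrite /subst_e /= mmapU; transitivity (1 * monomial_subst h (ucm i)).
  by congr (_ * _); apply: rmorph1.
by rewrite mul1r /monomial_subst mdomU big_seq_fset1 cmUU expr1.
Qed.

Section FormalPowerSeries.
Implicit Types (f g : fps) (m d : {cmonom nat}).

Lemma fps_addE f g m : (f + g) m = f m + g m. Proof. by []. Qed.

Lemma fps0E m : (0 : fps) m = 0. Proof. exact: mul0rn. Qed.

Lemma fps_sumE (I : Type) (r : seq I) (Q : pred I) (F : I -> fps) m :
  (\sum_(i <- r | Q i) F i) m = \sum_(i <- r | Q i) F i m.
Proof.
by elim/big_rec2: _ => [|i a b _ <-] //; apply: fps0E.
Qed.

Lemma fps_mulE f g m : (f * g) m = \sum_(d <- mdivs m) f d * g (divcm m d).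
Proof. by []. Qed.

Lemma fpsCM a f m : (fpsC a * f) m = a * f m.
Proof.
rewrite fps_mulE (big_fsetD1 mone) /=; last first.
  by rewrite mdivsP; apply/mdividesP => i; rewrite cm1.
rewrite {1}/fpsC eqxx big1_fset ?addr0.
  by congr (_ * f _); apply/eqP/cmP => i; rewrite divcmE cm1 subn0.
by move=> d; rewrite in_fsetD1 /fpsC => /andP[/negbTE -> _] _; rewrite mul0r.
Qed.

Lemma fpsC_is_additive : zmod_morphism fpsC.
Proof. by move=> a b; apply/funext => m; rewrite /fpsC mulrnBl. Qed.

Lemma fpsC_is_multiplicative : monoid_morphism fpsC.
Proof.
split=> // a b; apply/funext => m.
by rewrite fpsCM /fpsC mulrnAr.
Qed.

HB.instance Definition _ := GRing.isZmodMorphism.Build rat fps fpsC fpsC_is_additive.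
HB.instance Definition _ := GRing.isMonoidMorphism.Build rat fps fpsC fpsC_is_multiplicative.

Definition monom_fps d : fps := fun m => (m == d)%:R.

Lemma monom_fpsM d f m :
  (monom_fps d * f) m = if mdivides d m then f (divcm m d) else 0.
Proof.
rewrite fps_mulE; case: ifPn => [dm|ndm].
  rewrite (big_fsetD1 d) ?mdivsP //= {1}/monom_fps eqxx mul1r big1_fset ?addr0 //.
  by move=> d'; rewrite in_fsetD1 /monom_fps => /andP[/negbTE -> _] _; rewrite mul0r.
rewrite big_seq big1 // => d'; rewrite mdivsP /monom_fps => d'm.
by case: eqP d'm => [->|]; rewrite ?(negbTE ndm) ?mul0r.
Qed.

Lemma monom_fps_mul d d' : monom_fps d * monom_fps d' = monom_fps (mmul d d').
Proof.
apply/funext => m; rewrite monom_fpsM /monom_fps; case: ifPn => [dm|ndm].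
  congr (nat_of_bool _)%:R; apply/eqP/eqP => [<-|->]; first by rewrite mdividesK.
  exact: divcmMl.
by case: eqP ndm => // ->; rewrite mdividesMl.
Qed.

Lemma monom_fps1 : monom_fps mone = 1.
Proof. by apply/funext => m; rewrite (_ : 1 = fpsC 1) // /monom_fps /fpsC; case: eqP. Qed.

Definition var_fps (i : nat) : fps := monom_fps (ucm i).

Lemma prod_var_fps (I : Type) (r : seq I) (F : I -> nat) :
  \prod_(i <- r) var_fps (F i) = monom_fps (\big[mmul/mone]_(i <- r) ucm (F i)).
Proof.
elim: r => [|i r IHr]; first by rewrite !big_nil monom_fps1.
by rewrite !big_cons IHr monom_fps_mul.
Qed.

Lemma mdivides_trans d m m' : mdivides d m -> mdivides m m' -> mdivides d m'.
Proof.
move=> /mdividesP dm /mdividesP mm'; apply/mdividesP => i; exact: leq_trans (dm i) _.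
Qed.

Lemma mdivides_divcm d m : mdivides (divcm m d) m.
Proof. by apply/mdividesP => i; rewrite divcmE leq_subr. Qed.

(* The coefficient at m only sees the variables dividing m, so that the       *)
(* elementary symmetric polynomials in these can replace [elem].              *)
Definition agree m f g := forall d, mdivides d m -> f d = g d.

Lemma agreeD m f f' g g' : agree m f f' -> agree m g g' -> agree m (f + g) (f' + g').
Proof. by move=> ef eg d dm; rewrite !fps_addE ef ?eg. Qed.

Lemma agreeM m f f' g g' : agree m f f' -> agree m g g' -> agree m (f * g) (f' * g').
Proof.
move=> ef eg d dm; rewrite !fps_mulE big_seq [RHS]big_seq; apply: eq_bigr => d'.
rewrite mdivsP => d'd; congr (_ * _); first exact/ef/(mdivides_trans d'd).
exact/eg/(mdivides_trans (mdivides_divcm _ _)).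
Qed.

Lemma agreeX m f g n : agree m f g -> agree m (f ^+ n) (g ^+ n).
Proof.
move=> e; elim: n => [|n IHn] //; rewrite !exprS; exact: agreeM.
Qed.

Lemma agree_subst m (h h' : nat -> fps) (p : epoly) :
  (forall i, agree m (h i) (h' i)) ->
  agree m (subst_e h fpsC p) (subst_e h' fpsC p).
Proof.
move=> hh'; rewrite /subst_e /= /mmap; elim/big_rec2: _ => // k f g _ efg.
apply: agreeD efg; apply: agreeM => //; rewrite /monomial_subst.
by elim/big_rec2: _ => // i f' g' _ e; apply: agreeM e; apply: agreeX.
Qed.

Definition squarefree_in (s : seq nat) d := all (fun j => d j <= (j \in s))%N (finsupp d).

Lemma squarefree_inP s d : reflect (forall j, d j <= (j \in s))%N (squarefree_in s d).
Proof.
by apply: (iffP allP) => [H j|H j _]; [case: (mdomP d j) => [/H|] | apply: H].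
Qed.

Lemma mdivides_ucm z d : mdivides (ucm z) d = (0 < d z)%N.
Proof.
apply/mdividesP/idP => [/(_ z)|dz i]; first by rewrite cmUU.
by rewrite cmU; case: eqP => // <-.
Qed.

Lemma squarefree_in_cons s z d : z \notin s -> (0 < d z)%N ->
  squarefree_in (z :: s) d = squarefree_in s (divcm d (ucm z)).
Proof.
move=> zs dz; apply/squarefree_inP/squarefree_inP => H j; have := H j;
  rewrite divcmE cmU inE; have [->|_] := eqVneq j z; rewrite ?subn0 //=.
- by rewrite (negbTE zs) leqn0 subn_eq0.
- by rewrite (negbTE zs) leqn0 subn_eq0.
Qed.

Lemma esym_var_fps (s : seq nat) i d : uniq s ->
  esym var_fps s i d = ((mdeg d == i) && squarefree_in s d)%:R.
Proof.
elim: s i d => [|z s IHs] i d /=.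
  move=> _; have -> : squarefree_in [::] d = (d == mone).
    apply/squarefree_inP/eqP => [H|-> j]; last by rewrite cm1.
    by apply/eqP/cmP => j; have := H j; rewrite leqn0 cm1 => /eqP.
  case: i => [|i] /=; first by rewrite (_ : 1 = fpsC 1) // mdeg_eq0 andbb.
  by rewrite mulr0n fps0E; case: eqP => //; case: eqP => // ->; rewrite mdeg1.
case/andP=> zs us; rewrite fps_addE monom_fpsM mdivides_ucm IHs //.
have [dz|dz] := posnP (d z).
  rewrite addr0; congr (nat_of_bool (_ && _))%:R.
  apply/squarefree_inP/squarefree_inP => H j; have := H j; rewrite inE.
    by move=> h; apply: leq_trans h _; case: (j \in s); rewrite ?orbT.
  by have [->|] := eqVneq j z; rewrite ?dz.
have -> : squarefree_in s d = false.
  by apply/squarefree_inP => /(_ z); rewrite (negbTE zs) leqNgt dz.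
rewrite andbF add0r squarefree_in_cons //.
have dE : d = mmul (ucm z) (divcm d (ucm z)) by rewrite mdividesK // mdivides_ucm.
have -> : mdeg d = (mdeg (divcm d (ucm z))).+1 by rewrite [in LHS]dE mdegM mdegU.
by case: i => [|i]; rewrite ?fps0E // IHs.
Qed.

Lemma agree_elem m (s : seq nat) i : uniq s -> finsupp m =i s ->
  agree m (elem i) (esym var_fps s i).
Proof.
move=> us ms d /mdividesP dm; rewrite esym_var_fps // /elem.
congr (nat_of_bool (_ && _))%:R; apply: eq_in_all => j jd; rewrite -ms -cmE_neq0.
move: jd; rewrite -cmE_neq0 -!lt0n => jd; by rewrite (leq_trans jd).
Qed.

End FormalPowerSeries.

Section Chromatic.
Variables (n : nat) (e : rel 'I_n).
Hypotheses (e_sym : symmetric e) (e_irr : irreflexive e) (e_nui : natural_unit_interval e).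

Definition chromatic_poly : epoly := constant_terms
  (outcome (@mark_terms epoly) (unmark_terms (power_sum e_gen)) [:: (1, [::])]
    [seq smaller_degree e v | v <- enum 'I_n]).

(** Coefficient by coefficient: at m only the variables of its support matter, and for this finite
    set Newton's identities send [power_sum e_gen] to true power sums. *)
Lemma chromatic_polyE : chromatic e = esubst chromatic_poly.
Proof.
apply/funext => m; pose T := (finsupp m : finType).
pose S := [seq val t | t <- enum T].
have uS : uniq S by rewrite map_inj_uniq ?enum_uniq //; apply: val_inj.
have mS : finsupp m =i S.
  move=> i; apply/idP/mapP => [im|[t _ ->]]; last exact: valP.
  by exists (FSetSub im); rewrite ?mem_enum.
pose ev := subst_e (fun i => esym var_fps S i.+1) fpsC.
have ev_gen i : ev (e_gen i) = esym var_fps S i.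
  by case: i => [|i]; [rewrite esym0 rmorph1 | rewrite subst_e_gen].
have ev_sum a : ev (power_sum e_gen a) = \sum_(z <- S) var_fps z ^+ a.+1.
  move: a; apply: (newton_sum_inj (e := esym var_fps S)); first exact: esym0.
  move=> i; rewrite esym_newton -ev_gen.
  have := congr1 ev (power_sumP (e := e_gen) i (erefl _)).
  rewrite rmorphM rmorph_nat => <-; rewrite /newton_sum rmorph_sum.
  apply: eq_bigr => j _; rewrite !rmorphM /= rmorphXn rmorphN1.
  by rewrite -ev_gen.
transitivity (ev chromatic_poly m); last first.
  symmetry; apply: (@agree_subst m (fun i => elem i.+1)); last exact/mdividesP.
  by move=> i; apply: agree_elem.
rewrite /chromatic_poly -(color_outcome (x := var_fps) uS ev_sum).
rewrite (chromatic_outcome e_sym e_irr e_nui (fun t : T => val t)).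
rewrite fps_sumE /chromatic -sum1_card natr_sum [RHS]big_mkcond [LHS]big_mkcond.
apply: eq_bigr => kappa _; rewrite inE; case: (Defs.proper _ _) => //=.
by rewrite prod_var_fps /monom_fps eq_sym; case: eqP.
Qed.

End Chromatic.

(** * The operators of the statement *)

Section Scalars.

Lemma tofrac_inj (R : idomainType) : injective (@tofrac R).
Proof. by move=> a b /eqP; rewrite tofrac_eq => /eqP. Qed.

Lemma natQe_neq0 k : k.+1%:R != 0 :> Qe.
Proof.
rewrite -tofrac1 -tofracMn tofrac_eq0; apply/eqP => /(congr1 (mcoeff mone)).
by rewrite mcoeffMn mcoeff1 eqxx mcoeff0 => /eqP; rewrite Num.Theory.pnatr_eq0.
Qed.

Lemma ratQe_is_additive : zmod_morphism ratQe.
Proof. by move=> a b; rewrite /ratQe !raddfB. Qed.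

Lemma ratQe_is_multiplicative : monoid_morphism ratQe.
Proof.
split=> [|a b]; first exact: tofrac1.
by rewrite /ratQe -tofracM -mpolyCM.
Qed.

HB.instance Definition _ := GRing.isZmodMorphism.Build rat Qe ratQe ratQe_is_additive.
HB.instance Definition _ := GRing.isMonoidMorphism.Build rat Qe ratQe ratQe_is_multiplicative.

Lemma ratQe_Acoef y s : ratQe (Acoef y s) = append_coef Qe y s.
Proof.
rewrite /Acoef /append_coef; case: ifP => _.
  by rewrite rmorph_prod; apply: eq_bigr => t _; rewrite fmorph_div rmorphB rmorph1 !rmorph_nat.
case: ifP => _; last by rewrite rmorph0.
rewrite rmorphM fmorph_div rmorphD rmorph1 !rmorph_nat rmorph_prod; congr (_ * _).
by apply: eq_bigr => t _; rewrite fmorph_div rmorphD rmorphB rmorph1 !rmorph_nat.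
Qed.

Lemma eQ_tofrac i : eQ i = tofrac (e_gen i).
Proof. by case: i => [|i]; rewrite //= tofrac1. Qed.

Lemma e_gen_neq0 i : e_gen i != 0.
Proof.
case: i => [|i]; first exact: oner_neq0.
by apply/eqP => /(congr1 (mcoeff (ucm i))); rewrite mcoeffUU mcoeff0 => /eqP; rewrite oner_eq0.
Qed.

End Scalars.

Definition qQe s : Qe := eQ s / eQ s.-1.

Section Pairing.
Implicit Types (k : nat) (phi : seq nat -> Qe).

Definition pairing k phi (v : Vsp k) : Qe := \sum_(s <- msupp v) v@_s * phi (val s).

Lemma pairing_wide k phi (v : Vsp k) (d : {fset Idx k}) : (msupp v `<=` d)%fset ->
  pairing phi v = \sum_(s <- d) v@_s * phi (val s).
Proof.
move=> le_d; rewrite /pairing (big_fset_incl _ le_d) // => s _ /mcoeff_outdom ->.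
by rewrite mul0r.
Qed.

Lemma pairing_is_linear k phi : scalar (@pairing k phi).
Proof.
move=> a u v; set d := (msupp u `|` msupp v `|` msupp (a *: u + v))%fset.
rewrite !(@pairing_wide _ _ _ d); try by apply/fsubsetP => x xin; rewrite !in_fsetU xin ?orbT.
rewrite mulr_sumr -big_split /=; apply: eq_bigr => s _.
by rewrite mcoeffD mcoeffZ mulrDl mulrA.
Qed.

HB.instance Definition _ k phi :=
  GRing.isLinear.Build Qe (Vsp k) Qe *%R (@pairing k phi) (@pairing_is_linear k phi).

Lemma pairing_basis k phi (s : Idx k) : pairing phi << s >> = phi (val s).
Proof.
by rewrite (pairing_wide _ msuppU_le) big_seq_fset1 mcoeffUU mul1r.
Qed.

Lemma pairing_bvec k phi (t : k.-tuple nat) : good t -> pairing phi (bvec t) = phi t.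
Proof.
by move=> gt; rewrite /bvec insubT pairing_basis.
Qed.

Lemma pairing_linext k l phi (psi : seq nat -> Qe) (F : Idx k -> Vsp l) (v : Vsp k) :
  (forall s, pairing phi (F s) = psi (val s)) ->
  pairing phi (linext F v) = pairing psi v.
Proof.
by move=> FE; rewrite /linext linear_sum; apply: eq_bigr => s _; rewrite linearZ /= FE.
Qed.

Lemma pairing_Mop k phi (v : Vsp k) : pairing phi (Mop k v) = pairing (mark phi) v.
Proof.
apply: pairing_linext => s; have gs : good (val s) := valP s.
rewrite linear_sum big_mkcond; apply: eq_big_nat => y /andP[y0 _].
case: ifPn => [ys|/negbNE ys]; last by rewrite (append_coef_mem natQe_neq0 gs ys) mul0r.
by rewrite linearZ /= ratQe_Acoef pairing_bvec //= good_rcons y0 ys.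
Qed.

Lemma pairing_Dop k phi (v : Vsp k.+1) : pairing phi (Dop k v) = pairing (unmark qQe phi) v.
Proof.
apply: pairing_linext => s; have gs : good (val s) := valP s.
case: s gs => -[[|c s] //= sz] /= gs' gs; rewrite linearZ /= pairing_bvec //.
by move: gs; rewrite good_cons => /and3P[].
Qed.

Definition mark_functional (L : (seq nat -> Qe) -> Qe) phi := L (mark phi).
Definition unmark_functional (L : (seq nat -> Qe) -> Qe) phi := L (unmark qQe phi).

Definition state_functional (F : from_V0) phi : Qe :=
  pairing phi (tagged F << empty_idx >>).

Lemma forget_oldest_functional F j : (j <= tag F)%N ->
  tag (iter j forget_oldest F) = (tag F - j)%N /\
  state_functional (iter j forget_oldest F) =
  iter j unmark_functional (state_functional F).
Proof.
elim: j => [|j IHj] le_j; first by rewrite subn0.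
have [] := IHj (ltnW le_j); rewrite !iterS; case: (iter j forget_oldest F) => -[|s] f /= es <-.
  by move: le_j; rewrite -subn_gt0 -es.
split; first by rewrite subnS -es.
by apply/funext => phi; rewrite /state_functional /unmark_functional /= pairing_Dop.
Qed.

Lemma mark_new_functional ds (F0 := existT _ 0%N (idfun : {linear Vsp 0 -> Vsp 0}) : from_V0) :
  let F := foldl (fun F r => mark_new r F) F0 ds in
  let st := process mark_functional unmark_functional (fun phi => phi [::]) ds in
  tag F = st.1 /\ state_functional F = st.2.
Proof.
elim/last_ind: ds => [|ds r IH] /=.
  by split=> //; apply/funext => phi; rewrite /state_functional pairing_basis.
rewrite /process in IH *; rewrite !foldl_rcons.
case: (foldl (add_vertex _ _) _ ds) IH => s L /=.
case: (foldl _ F0 ds) => s0 f /= [es EL]; subst s0.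
rewrite /mark_new /forget_to /add_vertex /=.
have [] := @forget_oldest_functional (existT _ s f) (s - r) (leq_subr _ _).
rewrite EL; case: (iter _ _ _) => s' f' /= es' <-; split; first by rewrite es'.
by apply/funext => phi; rewrite /state_functional /mark_functional /= pairing_Mop.
Qed.

Lemma pairing_forget_all s phi (v : Vsp s) :
  pairing phi (forget_all s v) = pairing (iter s (unmark qQe) phi) v.
Proof. by elim: s v => //= s IHs v; rewrite IHs pairing_Dop. Qed.

Lemma iter_unmark_functional s L phi :
  iter s unmark_functional L phi = L (iter s (unmark qQe) phi).
Proof. by elim: s phi => //= s IHs phi; rewrite /unmark_functional IHs -iterSr. Qed.

Lemma pairing_empty_idx (v : Vsp 0) : pairing (fun=> 1) v = v@_empty_idx.
Proof.
rewrite (@pairing_wide _ _ _ [fset empty_idx]%fset) ?big_seq_fset1 ?mulr1 //.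
by apply/fsubsetP => s _; rewrite in_fset1; apply/eqP/val_inj/val_inj; case: s => -[[]].
Qed.

(** Composing an operator on the left acts on functionals by its transpose, so the whole product is
    evaluated by the process on functionals. *)
Lemma MG_outcome n (e : rel 'I_n) : MG e =
  outcome mark_functional unmark_functional (fun phi => phi [::])
    [seq smaller_degree e v | v <- enum 'I_n] (fun=> 1).
Proof.
rewrite /MG /outcome; have [] := mark_new_functional [seq smaller_degree e v | v <- enum 'I_n].
have -> F0 (l : seq 'I_n) : foldl (fun F r => mark_new r F) F0 [seq smaller_degree e v | v <- l]
    = foldl (fun F v => mark_new (smaller_degree e v) F) F0 l.
  by elim: l F0 => //= v l IHl F0; rewrite IHl.
case: foldl => s f /= es <-; rewrite -es iter_unmark_functional.
by rewrite /scalar_of -pairing_empty_idx pairing_forget_all.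
Qed.

End Pairing.

Section Terms_of_MG.
Implicit Types (phi : seq nat -> Qe) (L : (seq nat -> Qe) -> Qe).
Local Notation p := (power_sum e_gen).
Local Notation mono := (monomial qQe).

(** The current vector of V_s is the combination of the T_a encoded by l. *)
Definition functional_agree s (l : seq (epoly * seq nat)) L := terms_of_size s l /\
  forall phi, L phi = \sum_(t <- l) tofrac t.1 * mono t.2 phi.

Lemma functional_agree_mark s l L : functional_agree s l L ->
  functional_agree s.+1 (mark_terms l) (mark_functional L).
Proof.
case=> sl eL; split=> [|phi]; first exact: mark_terms_size.
by rewrite /mark_functional eL big_map.
Qed.

Lemma newton_Qe i : newton_sum (fun i => eQ i) (fun j => tofrac (p j)) i = i.+1%:R * eQ i.+1.
Proof.
rewrite !eQ_tofrac -[i.+1%:R](rmorph_nat (@tofrac epoly)) -tofracM -power_sumP //.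
rewrite /newton_sum rmorph_sum; apply: eq_bigr => j _.
by rewrite eQ_tofrac /= !tofracM tofracXn tofracN tofrac1.
Qed.

Lemma functional_agree_unmark s l L : functional_agree s.+1 l L ->
  functional_agree s (unmark_terms p l) (unmark_functional L).
Proof.
case=> sl eL; split=> [|phi]; first exact: unmark_terms_size.
rewrite /unmark_functional eL.
apply: (sum_unmark_terms (F := fun a r => tofrac a * mono r phi)
  (G := fun a r => tofrac a * mono r (unmark qQe phi)) sl) => a r b _.
rewrite (monomial_unmark natQe_neq0 (e := eQ) (p := fun j => tofrac (p j))) //.
- rewrite mulrBr mulrA -tofracM mulr_sumr -sumrN; congr (_ + _).
  by apply: eq_bigr => t _; rewrite tofracN mulNr.
- by move=> i; rewrite eQ_tofrac tofrac_eq0 e_gen_neq0.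
- exact: newton_Qe.
Qed.

End Terms_of_MG.

Lemma MG_chromatic_poly n (e : rel 'I_n) : MG e = tofrac (chromatic_poly e).
Proof.
rewrite MG_outcome.
have [] := @outcome_rel _ _ (@mark_terms epoly) (unmark_terms (power_sum e_gen))
  mark_functional unmark_functional functional_agree functional_agree_unmark
  functional_agree_mark [:: (1, [::])] (fun phi => phi [::])
  [seq smaller_degree e v | v <- enum 'I_n].
  split=> [t|phi]; first by rewrite inE => /eqP->.
  by rewrite big_seq1 /= tofrac1 mul1r.
move=> sl -> //; rewrite /chromatic_poly /constant_terms rmorph_sum /= big_seq [RHS]big_seq.
by apply: eq_bigr => t /sl; case: (t.2) => // _; rewrite mulr1.
Qed.

(** * Positivity *)

Section Positivity.
Import Order.TTheory Num.Theory.
Implicit Types (phi : seq nat -> Qe) (s acc : seq nat).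

Definition e_positive (a : Qe) :=
  exists p : epoly, a = tofrac p /\ forall m : {cmonom nat}, 0 <= p@_m.

Lemma e_positive0 : e_positive 0.
Proof. by exists 0; rewrite tofrac0; split=> // m; rewrite mcoeff0. Qed.

Lemma e_positiveD a b : e_positive a -> e_positive b -> e_positive (a + b).
Proof.
move=> [p [-> p0]] [p' [-> p'0]]; exists (p + p'); rewrite tofracD; split=> // m.
by rewrite mcoeffD addr_ge0.
Qed.

Lemma e_positiveM a b : e_positive a -> e_positive b -> e_positive (a * b).
Proof.
move=> [p [-> p0]] [p' [-> p'0]]; exists (p * p'); rewrite tofracM; split=> // m.
rewrite mcoeffMl !sumr_ge0 // => k _; rewrite sumr_ge0 // => k' _.
by rewrite mulrn_wge0 // mulr_ge0.
Qed.

Lemma e_positive_rat c : 0 <= c -> e_positive (ratQe c).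
Proof.
by move=> c0; exists c%:MP; split=> // m; rewrite mcoeffC mulrn_wge0.
Qed.

Lemma e_positive_eQ i : e_positive (eQ i).
Proof.
rewrite eQ_tofrac; exists (e_gen i); split=> // m.
by case: i => [|i] /=; [rewrite mcoeff1 ler0n | rewrite mcoeffU mulrn_wge0].
Qed.

Lemma e_positive_sum (I : Type) (r : seq I) (Q : pred I) (F : I -> Qe) :
  (forall i, Q i -> e_positive (F i)) -> e_positive (\sum_(i <- r | Q i) F i).
Proof.
by move=> F0; elim/big_rec: _ => [|i a Qi a0]; [apply: e_positive0 | apply/e_positiveD/a0/F0].
Qed.

(** For integers t different from y - 1, the numerator y - t and denominator y - 1 - t never have
    opposite signs. *)
Lemma Acoef_ge0 y s : good s -> y \notin s -> 0 <= Acoef y s.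
Proof.
move=> /andP[_ /allP s1] ys; rewrite /Acoef; case: ifP => _.
  rewrite big_seq prodr_ge0 // => t /s1 t1.
  by rewrite divr_ge0 ?ler0n // subr_ge0 ler1n.
case: ifP => // cs; rewrite mulr_ge0 //.
  by rewrite divr_ge0 ?addr_ge0 ?ler0n ?ler01.
rewrite big_seq_cond prodr_ge0 // => t /andP[ts].
case: (ltngtP t y.-1) => // [lt_t|gt_t] _.
  have d0 : 0 <= y.-1%:R - t%:R :> rat by rewrite subr_ge0 ler_nat ltnW.
  by rewrite divr_ge0 // addr_ge0 ?ler01.
have le_t := ltnW gt_t; rewrite mulr_le0 ?invr_le0 ?subr_le0 ?ler_nat //.
by rewrite addrAC natr1 subr_le0 ler_nat.
Qed.

(* The e-factor still owed: each maximal marked part of a column that starts   *)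
(* at height x stands on a forgotten part of height x - 1.                     *)
Fixpoint column_weight acc s : Qe :=
  if s is x :: s' then
    (if x.-1 \in acc then 1 else eQ x.-1) * column_weight (x :: acc) s'
  else 1.

Lemma column_weight_rcons acc s y : column_weight acc (rcons s y) =
  column_weight acc s * (if y.-1 \in s ++ acc then 1 else eQ y.-1).
Proof.
elim: s acc => [|x s IHs] acc /=; first by rewrite mul1r mulr1.
by rewrite IHs mulrA !(inE, mem_cat) orbCA.
Qed.

(** Membership of c in [acc] only affects an entry c + 1. *)
Lemma eq_column_weight acc acc' c s : all (leq 1) s -> c.+1 \notin s ->
  (forall z, z != c -> (z \in acc) = (z \in acc')) ->
  column_weight acc s = column_weight acc' s.
Proof.
elim: s acc acc' => //= x s IHs acc acc' /andP[x1 s1].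
rewrite inE negb_or => /andP[xc sc] eacc; rewrite eacc; last first.
  by apply: contraNneq xc => <-; rewrite prednK.
congr (_ * _); apply: IHs => // z zc; by rewrite !inE eacc.
Qed.

(** Forgetting c leaves a factor e_c: if c + 1 is marked, it becomes the debt of the part starting
    there; otherwise the column is finished and e_c is its contribution. *)
Lemma column_weight_forget c s acc acc' : good s -> c \notin s -> c \notin acc ->
  acc' =i c :: acc ->
  eQ c * column_weight acc' s
  = column_weight acc s * (if c.+1 \in s then 1 else eQ c).
Proof.
elim: s acc acc' => [|x s IHs] acc acc'; first by rewrite /= mulr1 mul1r.
rewrite good_cons inE negb_or => /and3P[x0 xs gs] /andP[cx cs] cacc eacc /=.
rewrite eacc !inE; have [xc|xc] := eqVneq c.+1 x.
  subst x; rewrite /= eqxx mul1r (negbTE cacc) mulr1; congr (_ * _).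
  apply: (@eq_column_weight _ _ c) => // [|z zc]; first by case/andP: gs.
  by rewrite !inE eacc inE (negbTE zc).
have -> : (x.-1 == c) = false.
  by apply: contraNF xc => /eqP <-; rewrite prednK.
rewrite /= mulrCA -[RHS]mulrA; congr (_ * _); apply: IHs => //.
  by rewrite inE negb_or cx.
by move=> z; rewrite !inE eacc inE orbCA.
Qed.

Definition positive_functional k phi := forall s, good s -> size s = k ->
  e_positive (phi s * column_weight [::] s).

(** A new entry with nonzero coefficient is 1 or stands on a marked entry, so it adds no debt (e_0 =
    1). *)
Lemma positive_mark k phi : positive_functional k.+1 phi -> positive_functional k (mark phi).
Proof.
move=> phi0 s gs ss; rewrite /mark mulr_suml big_nat_cond; apply: e_positive_sum => y.
rewrite andbT => /andP[y1 _].
have [ys|ys] := boolP (y \in s).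
  by rewrite (append_coef_mem natQe_neq0 gs ys) !mul0r; apply: e_positive0.
have [A0|A0] := eqVneq (append_coef Qe y s) 0; first by rewrite A0 !mul0r; apply: e_positive0.
rewrite -mulrA; apply: e_positiveM.
  by rewrite -ratQe_Acoef; apply/e_positive_rat/Acoef_ge0.
have := phi0 (rcons s y); rewrite column_weight_rcons cats0.
have -> : (if y.-1 \in s then 1 else eQ y.-1) = 1.
  case: ifPn => // y1s; have [-> //|ny1] := eqVneq y 1%N.
  by rewrite append_coef_eq0 // in A0; rewrite eqxx in A0.
by rewrite mulr1; apply; rewrite ?size_rcons ?ss // good_rcons y1 ys.
Qed.

(** The denominator e_(c-1) of D cancels the debt of the oldest entry c. *)
Lemma positive_unmark k phi : positive_functional k phi ->
  positive_functional k.+1 (unmark qQe phi).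
Proof.
move=> phi0 [|c s] // gcs [ss]; have := gcs; rewrite good_cons => /and3P[c0 cs gs] /=.
have ec0 : eQ c.-1 != 0 by rewrite eQ_tofrac tofrac_eq0 e_gen_neq0.
have -> : qQe c * phi s * (eQ c.-1 * column_weight [:: c] s)
    = phi s * (eQ c * column_weight [:: c] s).
  by rewrite mulrACA /qQe divfK // mulrCA.
rewrite (@column_weight_forget c s [::]) // mulrA; apply: e_positiveM; first exact: phi0.
by case: ifP => _; [apply: (e_positive_eQ 0) | apply: e_positive_eQ].
Qed.

Lemma MG_e_positive n (e : rel 'I_n) : e_positive (MG e).
Proof.
rewrite MG_outcome.
pose R k L (_ : unit) := forall phi, positive_functional k phi -> e_positive (L phi).
(* A second run on [unit] turns the relation into an invariant of the first run alone. *)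
apply: (@outcome_rel _ _ mark_functional unmark_functional id id R _ _ _ tt).
- by move=> k L u RL phi /positive_unmark; apply: RL.
- by move=> k L u RL phi /positive_mark; apply: RL.
- by move=> phi /(_ [::] isT erefl); rewrite mulr1.
- by case=> // _ _; rewrite mulr1; apply: (e_positive_eQ 0).
Qed.

End Positivity.

(* MathComp; equality with an element of Q(e_1, e_2, ...) is read through
   the substitution esubst of the elementary symmetric functions. *)
Theorem theorem23 (n : nat) (e : rel 'I_n)
    (e_sym : symmetric e) (e_irr : irreflexive e)
    (e_nui : natural_unit_interval e) :
  exists p : {malg rat[{cmonom nat}]},
    [/\ MG e = tofrac p,
        chromatic e = esubst p
      & forall m : {cmonom nat}, 0 <= p@_m].
Proof.
have [p [eMG p0]] := MG_e_positive e; exists p; split=> //.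
rewrite (chromatic_polyE e_sym e_irr e_nui); congr esubst.
(* The positive polynomial and [chromatic_poly] have the same image [MG e] in the fraction field. *)
by apply: tofrac_inj; rewrite -MG_chromatic_poly.
Qed.
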